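(* Let $T$ be a tree with $k\ge 1$ edges, with vertex set $\{1,\dots,k+1\}$ and edge set $\mathcal{E}(T)$. Let $E \subset \mathbb{R}^d$ be compact with Hausdorff dimension $\dim_{\mathcal{H}}(E) > (d+1)/2$. Then the set $$\Lambda_T(E) = \{(x_i \cdot x_j)_{(i,j) \in \mathcal{E}(T)} : (x_1,\ldots, x_{k+1}) \in E^{k+1}\} \subset \mathbb{R}^k$$ has positive Lebesgue measure: $|\Lambda_T(E)| > 0$.
   Context: Here $|\cdot|$ denotes Lebesgue measure (on $\mathbb{R}^k$) and $x\cdot y$ is the Euclidean dot product on $\mathbb{R}^d$. *)

(* Defs.v *)
From HB Require Import structures.
From mathcomp Require Import all_boot all_order all_algebra.
From mathcomp Require Import all_classical all_reals all_analysis.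

Set Implicit Arguments.
Unset Strict Implicit.
Unset Printing Implicit Defensive.

Import Order.TTheory GRing.Theory Num.Theory.
Import numFieldNormedType.Exports.

Local Open Scope classical_set_scope.
Local Open Scope ring_scope.

Section Euclidean.
Context {R : realType} {d : nat}.
Implicit Types x y : 'rV[R]_d.

Definition dotp x y : R := \sum_(i < d) x ord0 i * y ord0 i.

(* The norm that the library puts on row vectors is the sup norm, so the
   Euclidean distance is written out. *)
Definition eucl_dist x y : R := Num.sqrt (dotp (x - y) (x - y)).

End Euclidean.

Section Hausdorff.
Context {R : realType} {d : nat}.
Implicit Types (A U : set 'rV[R]_d) (s delta : R).
Local Open Scope ereal_scope.

(* [eucl_diam set0 = -oo] *)
Definition eucl_diam U : \bar R :=
  ereal_sup [set (eucl_dist x y)%:E | x in U & y in U].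

(* diam(U)^s; the empty set contributes 0 even when s = 0, whereas
   [poweR x 0 = 1] for every [x]. *)
Definition hausdorff_gauge s U : \bar R :=
  if U == set0 then 0 else poweR (eucl_diam U) s.

Definition hausdorff_content delta s A : \bar R :=
  ereal_inf [set \sum_(0 <= i <oo) hausdorff_gauge s (U i) |
    U in [set U : (set 'rV[R]_d)^nat |
      (forall i, eucl_diam (U i) <= delta%:E) /\ A `<=` \bigcup_i U i]].

Definition hausdorff_measure s A : \bar R :=
  ereal_sup [set hausdorff_content delta s A |
    delta in [set delta : R | (0 < delta)%R]].

Definition hausdorff_dim A : \bar R :=
  ereal_inf [set s%:E |
    s in [set s : R | (0 <= s)%R /\ hausdorff_measure s A = 0]].

End Hausdorff.

(* Lebesgue measure on R^k, with k.-tuple R carrying the product (= Borel)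
   sigma-algebra: the k-fold product of [lebesgue_measure], transported from
   R * R^k to R^(k+1) by [tuple_cons]. *)
Section LebesgueTuple.
Context {R : realType}.
Local Open Scope ereal_scope.

Definition tuple_cons k (p : measurableTypeR R * k.-tuple (measurableTypeR R)) :
  k.+1.-tuple (measurableTypeR R) := [tuple of p.1 :: p.2].

Lemma measurable_tuple_cons k : measurable_fun [set: _] (@tuple_cons k).
Proof. exact: measurable_cons. Qed.

Section step.
Variables (k : nat)
  (m : {sigma_finite_measure set (k.-tuple (measurableTypeR R)) -> \bar R}).

Definition lebesgue_step : set (k.+1.-tuple (measurableTypeR R)) -> \bar R :=
  pushforward (@lebesgue_measure R \x m) (@tuple_cons k).

Let lebesgue_step0 : lebesgue_step set0 = 0.
Proof. by rewrite /lebesgue_step /pushforward preimage_set0 measure0. Qed.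

Let lebesgue_step_ge0 A : 0 <= lebesgue_step A.
Proof. by rewrite /lebesgue_step /pushforward; exact: measure_ge0. Qed.

Let lebesgue_step_sigma_additive : semi_sigma_additive lebesgue_step.
Proof.
move=> F mF tF mUF; rewrite /lebesgue_step /pushforward preimage_bigcup.
apply: measure_semi_sigma_additive.
- by move=> n; rewrite -[X in measurable X]setTI; exact: measurable_tuple_cons.
- apply/trivIsetP => /= i j _ _ ij; rewrite -preimage_setI.
  by move/trivIsetP : tF => /(_ _ _ _ _ ij) ->//; rewrite preimage_set0.
- rewrite -preimage_bigcup -[X in measurable X]setTI.
  exact: measurable_tuple_cons.
Qed.

HB.instance Definition _ := isMeasure.Build _ _ _ lebesgue_step
  lebesgue_step0 lebesgue_step_ge0 lebesgue_step_sigma_additive.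

Let lebesgue_step_sigma_finite : sigma_finite setT lebesgue_step.
Proof.
have /sigma_finiteP[F [UF ndF Foo]] := sigma_finiteT (@lebesgue_measure R).
have /sigma_finiteP[G [UG ndG Goo]] := sigma_finiteT m.
pose h (t : k.+1.-tuple (measurableTypeR R)) :
    measurableTypeR R * k.-tuple (measurableTypeR R) :=
  (thead t, [tuple of behead t]).
have mh : measurable_fun [set: _] h.
  apply/measurable_fun_pair => /=; last exact: measurable_behead.
  exact: measurable_tnth.
have hK p : h (tuple_cons p) = p.
  by case: p => x t; rewrite /h /=; congr pair; exact: val_inj.
exists (fun n => h @^-1` (F n `*` G n)).
  rewrite -preimage_bigcup; apply/esym; rewrite -subTset => t _ /=.
  have [n _ Fn] : (\bigcup_i F i) (h t).1 by rewrite -UF.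
  have [j _ Gj] : (\bigcup_i G i) (h t).2 by rewrite -UG.
  exists (maxn n j) => //; split.
    by move: Fn; apply/subsetPset/ndF/leq_maxl.
  by move: Gj; apply/subsetPset/ndG/leq_maxr.
move=> n; have [mF Fn] := Foo n; have [mG Gn] := Goo n; split.
  by rewrite -[X in measurable X]setTI; apply: mh => //; exact: measurableX.
rewrite /lebesgue_step /pushforward -comp_preimage.
rewrite (_ : h \o _ = id) ?preimage_id; last exact/funext.
by rewrite product_measure1E// lte_mul_pinfty// ge0_fin_numE.
Qed.

HB.instance Definition _ := Measure_isSigmaFinite.Build _ _ _
  lebesgue_step lebesgue_step_sigma_finite.

End step.

Fixpoint lebesgue_tuple k :
    {sigma_finite_measure set (k.-tuple (measurableTypeR R)) -> \bar R} :=
  match k with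
  | 0%N => \d_([tuple] : 0.-tuple (measurableTypeR R))
  | j.+1 => lebesgue_step (lebesgue_tuple j)
  end.

Lemma lebesgue_tuple_box k (A : 'I_k -> set (measurableTypeR R)) :
    (forall i, measurable (A i)) ->
  lebesgue_tuple k [set t | forall i, A i (tnth t i)] =
  \prod_(i < k) lebesgue_measure (A i).
Proof.
have mbox n (B : 'I_n -> set (measurableTypeR R)) : (forall i, measurable (B i)) ->
    measurable [set t : n.-tuple (measurableTypeR R) | forall i, B i (tnth t i)].
  move=> mB; rewrite (_ : [set t | _] =
      \big[setI/setT]_(i < n) ((fun t => tnth t i) @^-1` B i)).
    apply: bigsetI_measurable => i _; rewrite -[X in measurable X]setTI.
    exact: measurable_tnth.
  rewrite -bigcap_seq; apply/seteqP; split=> [t Bt i _|t Bt i]; first exact: Bt.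
  by apply: Bt; rewrite /= mem_index_enum.
elim: k A => [|k IH] A mA.
  rewrite big_ord0 /= diracE mem_set//=.
  by case.
rewrite big_ord_recl -IH//= /lebesgue_step /pushforward.
rewrite (_ : _ @^-1` _ = A ord0 `*` [set t | forall i, A (lift ord0 i) (tnth t i)]).
  by rewrite product_measure1E//; exact: (mbox _ (fun i => A (lift ord0 i))).
apply/seteqP; split=> -[x t] /=.
- move=> Axt; split=> [|i]; first exact: (Axt ord0).
  by have := Axt (lift ord0 i); rewrite tnthS.
- case=> A0 At i; have [j ->|->//] := unliftP ord0 i.
  by rewrite tnthS.
Qed.

End LebesgueTuple.

Section Tree.
Variable n : nat.
Implicit Type e : rel 'I_n.

Definition simple_graph e := symmetric e /\ irreflexive e.

Definition connected_graph e := forall u v, connect e u v.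

(* Closed walks of length 2 are excluded: [[:: u; v]] is a [ucycle] as soon as
   u and v are adjacent. *)
Definition acyclic_graph e := forall c : seq 'I_n, (2 < size c)%N -> ~ ucycle e c.

Definition is_tree e :=
  [/\ simple_graph e, connected_graph e & acyclic_graph e].

(* Each undirected edge is listed once, with its smaller endpoint first. *)
Definition edges e : {set 'I_n * 'I_n} :=
  [set p : 'I_n * 'I_n | (p.1 < p.2)%N && e p.1 p.2].

End Tree.

(* The coordinates of R^k are the edges, in the order of [enum (edges T)]; the
   equation on underlying sequences is solvable only when [#|edges T| = k]. *)
Definition tree_dot_set (R : realType) (d k : nat) (T : rel 'I_k.+1)
    (E : set 'rV[R]_d) : set (k.-tuple (measurableTypeR R)) :=
  [set v | exists x : 'I_k.+1 -> 'rV[R]_d, (forall i, E (x i)) /\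
    tval v = [seq dotp (x p.1) (x p.2) | p <- enum (edges T)]].

(* Main.v *)
(* The statement is reduced to a count of cells at scale [2 ^ -n].

   For (d+1)/2 < s < dim E, a discrete Frostman lemma gives weights [w] on the
   dyadic cubes of side [2 ^ -n] that meet E, with w(B(p, r)) <= C r ^ s for
   r >= 2 ^ -n and total mass bounded below, uniformly in n. With L = 2 ^ n, the
   large sieve bound
     \sum_x w_x |\sum_y w_y e(m x.y)|^2 <= C m ^ (d - 2 s)    (1 <= m <= L)
   is summable in m exactly because 2 s > d + 1, and summing it against a Fejer
   kernel bounds the weight of the triples with |x.(y - z)| <= 1/L by C / L. By
   Chebyshev and Cauchy-Schwarz there is a set G of cubes of mass bounded below
   such that, for every x in G, the numbers x.y with y in G meet at least kappa L
   cells of length 1/L. Adding the vertices of the tree one at a time, each joined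
   to an earlier one, yields (kappa L) ^ k cells of side 1/L that meet a
   C/L-neighbourhood of the dot product set. Since that set is compact, its
   measure is the limit of those of the neighbourhoods, hence >= kappa ^ k. *)

Require Import Defs.
From mathcomp Require Import all_boot all_order all_algebra.
From mathcomp Require Import all_classical all_reals all_analysis.
From mathcomp Require Import complex ring lra zify.

Set Implicit Arguments.
Unset Strict Implicit.
Unset Printing Implicit Defensive.

Import Order.TTheory GRing.Theory Num.Theory.
Import numFieldNormedType.Exports.
Local Open Scope classical_set_scope.
Local Open Scope ring_scope.

(** * Binomial coefficients and trigonometric bounds *)

(** At each scale only finite trigonometric sums over cube corners occur, with frequencies in the
    lattice [Z^d / L]; no Fourier transform of a measure is taken. The frequencies carry no factor 2
    pi. Phases are kept in [-1, 1], where the cosine is at least [cos 1]; this is the source of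
    every [cos 1] in the constants. The large sieve calls for nonnegative weights on lattice points
    that are large on a box and whose Fourier transform is explicit and small away from 0. Binomial
    coefficients qualify: their transform is a power of a cosine, which a Gaussian dominates, and
    they stay comparable to the central one within about a standard deviation of the centre. Pinning
    must survive iteration: a vertex just added may be the one to which the next is attached, so the
    points counted from a point of G have to lie in G again. *)

Lemma cos1_le_cos {R : realType} (u : R) : `|u| <= 1 -> cos 1 <= cos u.
Proof.
move=> u1; rewrite -(cos_norm u); case: (ltgtP `|u| 1) u1 => // [u1 _|-> _] //.
have pi2 : 1 <= (pi : R).
  by have := pi_ge2 R; lra.
by rewrite ltW// ltr_cos// in_itv /= ?normr_ge0 ?ler01 /= ?(le_trans (ltW u1)).
Qed.

Lemma sin_sqr_ge {R : realType} (u : R) : `|u| <= 1 ->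
  (cos 1 * u) ^+ 2 <= sin u ^+ 2.
Proof.
have pos (v : R) : 0 < v -> v <= 1 -> (cos 1 * v) ^+ 2 <= sin v ^+ 2.
  move=> v0 v1.
  have [|c] := @MVT R sin cos 0 v v0 (fun x _ => is_derive_sin x).
    by apply: continuous_subspaceT => x; exact: continuous_sin.
  rewrite in_itv /= => /andP[c0 cv]; rewrite sin0 !subr0 => ->.
  rewrite lerXn2r ?nnegrE ?mulr_ge0 ?(ltW (@cos1_gt0 R)) ?(ltW v0)//.
    apply: le_trans (@cos1_le_cos R c _); first exact/ltW/cos1_gt0.
    by rewrite gtr0_norm// (le_trans (ltW cv)).
  rewrite ler_wpM2r ?(ltW v0)// cos1_le_cos// gtr0_norm//.
  by rewrite (le_trans (ltW cv)).
case: (ltgtP u 0) => [u0|u0|->] u1.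
- have := pos (- u); rewrite mulrN sinN !sqrrN oppr_gt0; apply=> //.
  by move: u1; rewrite ltr0_norm.
- by apply: pos => //; move: u1; rewrite gtr0_norm.
- by rewrite mulr0 sin0.
Qed.

Lemma cos_sqr_le {R : realType} (u : R) : `|u| <= 1 ->
  cos u ^+ 2 <= expR (- (cos 1 * u) ^+ 2).
Proof.
move=> u1; rewrite cos2sin2; apply: le_trans (expR_ge1Dx _).
by rewrite lerD2l lerN2 sin_sqr_ge.
Qed.

Lemma central_binS p : ('C(p.+1.*2, p.+1) * p.+1 = 'C(p.*2, p) * (2 * p.*2.+1))%N.
Proof.
have H1 := mul_bin_diag p.*2.+2 p.
have H2 := mul_bin_down p.*2.+1 p.
move: H1 H2; rewrite doubleS /= (_ : p.*2.+1 - p = p.+1)%N; last by lia.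
set a := 'C(_, _); set b := 'C(_, _); set c := 'C(_, _).
rewrite (_ : p.*2.+2 = 2 * p.+1)%N; last by lia.
move=> H1 H2; have {H1} : (2 * a = b)%N.
  by apply/eqP; rewrite -(eqn_pmul2l (ltn0Sn p)) -H1; apply/eqP; ring.
by move=> <-; rewrite -mulnA (mulnC a) -H2; ring.
Qed.

(** The quotient of the right side by [16 ^ p] is 1 at [p = 1] and nondecreasing, because (2p+1)^2
    >= 4p(p+1). Squaring avoids the square root of [p]. *)
Lemma central_bin_lb (p : nat) : (0 < p)%N -> (16 ^ p <= 'C(p.*2, p) ^ 2 * (4 * p))%N.
Proof.
case: p => // p _; elim: p => [//|p IH].
have E := central_binS p.+1.
have h : (16 * (p.+2 * p.+1) <= (2 * (p.*2).+3) ^ 2)%N by lia.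
rewrite -(leq_pmul2r (isT : 0 < p.+2)%N) -(leq_pmul2r (isT : 0 < p.+1)%N).
rewrite (_ : 'C(p.+2.*2, p.+2) ^ 2 * (4 * p.+2) * p.+2 * p.+1 =
  ('C(p.+2.*2, p.+2) * p.+2) ^ 2 * (4 * p.+1))%N; last by rewrite !expnS !expn0; lia.
rewrite E expnS doubleS; move: IH h; set x := (16 ^ _)%N; set c := 'C(_, _).
set y := (2 * _)%N => IH h.
rewrite (_ : (c * y) ^ 2 * (4 * p.+1) = (c ^ 2 * (4 * p.+1)) * y ^ 2)%N;
  last by rewrite !expnS !expn0; lia.
apply: leq_trans (leq_mul IH h).
by rewrite leq_eqVlt; apply/orP; left; apply/eqP; lia.
Qed.

(** Passing from [k] to [k + 1] multiplies the coefficient by (p - k) / (p + k + 1), and the lower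
    bound 1 - k^2 / p for the ratio to the central one survives this factor. *)
Lemma off_center_bin_lb p k : (k ^ 2 <= p)%N ->
  ('C(p.*2, p) * (p - k ^ 2) <= 'C(p.*2, p + k) * p)%N.
Proof.
elim: k => [|k IH] kp; first by rewrite subn0 addn0.
have := IH ltac:(apply: leq_trans kp; rewrite leq_exp2r//) => {}IH.
have := mul_bin_left p.*2 (p + k); rewrite addnS.
move: IH; set a := 'C(_, p); set b := 'C(_, _ + k); set c := 'C(_, _.+1).
have -> : (p.*2 - (p + k) = p - k)%N by lia.
move=> IH E.
rewrite -(leq_pmul2r (ltn0Sn (p + k))).
rewrite (_ : c * p * (p + k).+1 = p * ((p + k).+1 * c))%N; last by ring.
rewrite E.
apply: (@leq_trans (a * (p - k ^ 2) * (p - k))); last first.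
  rewrite (_ : p * ((p - k) * b) = b * p * (p - k))%N; last by ring.
  by rewrite leq_mul2r IH orbT.
rewrite -!mulnA leq_mul2l; apply/orP; right.
have [q ->] : exists q, (p = k.+1 ^ 2 + q)%N by exists (p - k.+1 ^ 2)%N; lia.
have k2 : (k.+1 ^ 2 = k ^ 2 + k.*2.+1)%N by rewrite !expnS !expn0; lia.
have kk : (k <= k ^ 2)%N by rewrite !expnS !expn0; nia.
rewrite addKn k2 (_ : _ - k ^ 2 = q + k.*2.+1)%N; last by lia.
rewrite (_ : _ - k = q + (k ^ 2 + k + 1))%N; last by lia.
by rewrite !expnS !expn0; nia.
Qed.

(** For [p = 4 K ^ 2] the central coefficient is at least 4^p / (4 K), and an offset of at most [K]
    costs a factor at least 1 - 1/4; keeping 1/2 gives the 8. *)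
Lemma bin_lb K j : (0 < K)%N -> (4 * K ^ 2 - K <= j <= 4 * K ^ 2 + K)%N ->
  (4 ^ (4 * K ^ 2) <= 8 * K * 'C((4 * K ^ 2).*2, j))%N.
Proof.
set p := (4 * K ^ 2)%N => K0 /andP[pj jp].
have p0 : (0 < p)%N by rewrite muln_gt0 expn_gt0 K0.
have [k kK Ej] : exists2 k, (k <= K)%N & 'C(p.*2, j) = 'C(p.*2, p + k).
  have [le_pj|/ltnW le_jp] := leqP p j.
    by exists (j - p)%N; [lia|rewrite subnKC].
  exists (p - j)%N; first by lia.
  by rewrite -bin_sub; [congr ('C(_, _)); lia|lia].
rewrite {}Ej.
have cen : (4 ^ p <= 'C(p.*2, p) * (4 * K))%N.
  rewrite -(@leq_exp2r _ _ 2)// (_ : (4 ^ p) ^ 2 = 16 ^ p)%N; last first.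
    by rewrite -expnM [(p * 2)%N]mulnC expnM.
  apply: (leq_trans (central_bin_lb p0)).
  by rewrite leq_eqVlt; apply/orP; left; apply/eqP; rewrite /p !expnS !expn0; lia.
have k2 : (4 * k ^ 2 <= p)%N by rewrite leq_mul2l leq_exp2r.
have := off_center_bin_lb (leq_trans (leq_pmull _ (isT : 0 < 4)%N) k2).
move: cen; set a := 'C(_, p); set b := 'C(_, _) => cen off.
rewrite -(leq_pmul2r p0); apply: leq_trans (leq_mul cen (leqnn p)) _.
rewrite (_ : 8 * K * b * p = 8 * K * (b * p))%N; last by ring.
apply: leq_trans (leq_mul (leqnn _) off).
rewrite (_ : a * (4 * K) * p = 4 * K * a * p)%N; last by ring.
rewrite (_ : 8 * K * (a * (p - k ^ 2)) = 4 * K * a * (2 * (p - k ^ 2)))%N; last by ring.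
by rewrite leq_mul2l; apply/orP; right; lia.
Qed.

(** * Exponential sums *)

Definition cis {R : realType} (t : R) : R[i] := (cos t +i* sin t)%C.

Lemma cisD {R : realType} : {morph @cis R : s t / s + t >-> s * t}.
Proof.
by move=> s t; rewrite /cis cosD sinD; congr (_ +i* _)%C; rewrite addrC mulrC.
Qed.

Lemma cis0 {R : realType} : cis (0 : R) = 1.
Proof. by rewrite /cis cos0 sin0. Qed.

Lemma cisMn {R : realType} (t : R) n : cis (t *+ n) = cis t ^+ n.
Proof. by elim: n => [|n IH]; rewrite ?mulr0n ?cis0// mulrS exprS cisD IH. Qed.

Lemma Re_sum {R : realType} (I : Type) (r : seq I) (P : pred I) (F : I -> R[i]) :
  complex.Re (\sum_(i <- r | P i) F i) = \sum_(i <- r | P i) complex.Re (F i).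
Proof. by apply: (big_morph (@complex.Re R)) => // -[a b] [a' b']. Qed.

(** The left side is the real part of a product over coordinates, each factor being the binomial
    expansion of (exp(-iv/2) + exp(iv/2))^(2p). Centring at [p] makes every factor real. *)
Lemma binomial_transform {R : realType} d p (v : 'I_d -> R) :
  \sum_(j : {ffun 'I_d -> 'I_(p.*2).+1}) (\prod_i 'C(p.*2, j i)%:R) *
    cos (\sum_i ((j i)%:R - p%:R) * v i) =
  \prod_i (2 * cos (v i / 2)) ^+ p.*2.
Proof.
have dim1 (u : R) : \sum_(j < (p.*2).+1) ('C(p.*2, j)%:R : R)%:C%C *
      cis ((j%:R - p%:R) * u) = ((2 * cos (u / 2)) ^+ p.*2)%:C%C.
  rewrite rmorphXn/=.
  have -> : (2 * cos (u / 2))%:C%C = cis (- (u / 2)) + cis (u / 2) :> R[i].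
    rewrite /cis cosN sinN; apply/eqP; rewrite eq_complex /=.
    by rewrite addNr eqxx andbT; apply/eqP; ring.
  rewrite exprDn; apply: eq_bigr => j _.
  rewrite -!cisMn -cisD -[RHS]mulr_natl rmorph_nat; congr (_ * cis _).
  rewrite -(mulr_natr (- _)) -(mulr_natr (u / 2)) natrB ?leq_ord//.
  have -> : p.*2%:R = p%:R * 2 :> R by rewrite -muln2 natrM.
  by field.
transitivity (complex.Re (\prod_i ((2 * cos (v i / 2)) ^+ p.*2)%:C%C)); last first.
  by rewrite -rmorph_prod.
under [in RHS]eq_bigr do rewrite -dim1.
rewrite bigA_distr_bigA Re_sum; apply: eq_bigr => j _.
rewrite big_split/= -(big_morph _ cisD cis0) -[in RHS]rmorph_prod /=.
by rewrite mul0r subr0.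
Qed.

Lemma dotpC {R : realType} {d} (x y : 'rV[R]_d) : dotp x y = dotp y x.
Proof. by apply: eq_bigr => i _; rewrite mulrC. Qed.

Lemma dotpDl {R : realType} {d} (x y z : 'rV[R]_d) :
  dotp (x + y) z = dotp x z + dotp y z.
Proof. by rewrite -big_split; apply: eq_bigr => i _; rewrite mxE mulrDl. Qed.

Lemma dotpNl {R : realType} {d} (x y : 'rV[R]_d) : dotp (- x) y = - dotp x y.
Proof. by rewrite -sumrN; apply: eq_bigr => i _; rewrite mxE mulNr. Qed.

Lemma dotpZl {R : realType} {d} a (x y : 'rV[R]_d) :
  dotp (a *: x) y = a * dotp x y.
Proof. by rewrite mulr_sumr; apply: eq_bigr => i _; rewrite mxE mulrA. Qed.

Lemma dotpBr {R : realType} {d} (x y z : 'rV[R]_d) :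
  dotp x (y - z) = dotp x y - dotp x z.
Proof. by rewrite dotpC dotpDl dotpNl !(dotpC x). Qed.

(** Cauchy-Schwarz against the constant 1: the defect is half the sum of all (u i - u j)^2. *)
Lemma sqr_sum_le {R : realType} (J : finType) (A : pred J) (u : J -> R) :
  (\sum_(j | A j) u j) ^+ 2 <= #|A|%:R * \sum_(j | A j) u j ^+ 2.
Proof.
have : 0 <= \sum_(i | A i) \sum_(j | A j) (u i - u j) ^+ 2.
  by apply: sumr_ge0 => i _; apply: sumr_ge0 => j _; rewrite sqr_ge0.
have -> : \sum_(i | A i) \sum_(j | A j) (u i - u j) ^+ 2 =
   2 * (#|A|%:R * \sum_(j | A j) u j ^+ 2 - (\sum_(j | A j) u j) ^+ 2).
  set S := \sum_(j | A j) u j; set S2 := \sum_(j | A j) u j ^+ 2.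
  have inner i : \sum_(j | A j) (u i - u j) ^+ 2 =
      #|A|%:R * u i ^+ 2 + (S2 + - 2 * S * u i).
    under eq_bigr => j _.
      rewrite (_ : (u i - u j) ^+ 2 = u i ^+ 2 + (u j ^+ 2 + - 2 * u i * u j)).
        over.
      by ring.
    rewrite !big_split/= sumr_const mulr_natl -mulr_sumr -/S -/S2.
    by congr (_ + (_ + _)); ring.
  under eq_bigr do rewrite inner.
  rewrite !big_split/= -!mulr_sumr sumr_const -/S -/S2 -(mulr_natl S2).
  by ring.
by rewrite pmulr_rge0// subr_ge0.
Qed.

Section spectrum.
Context {R : realType} {d : nat} {I : finType}.
Variable y : I -> 'rV[R]_d.
Implicit Types (a : I -> R) (xi : 'rV[R]_d).

(* [|\sum_i a i * exp (sqrt -1 * (xi . y i))| ^ 2] *)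
Definition spec a xi : R :=
  (\sum_i a i * cos (dotp xi (y i))) ^+ 2 +
  (\sum_i a i * sin (dotp xi (y i))) ^+ 2.

Lemma spec_ge0 a xi : 0 <= spec a xi.
Proof. by rewrite addr_ge0 ?sqr_ge0. Qed.

Lemma specN a xi : spec a (- xi) = spec a xi.
Proof.
rewrite /spec; congr (_ + _).
  by under eq_bigr do rewrite dotpNl cosN.
by under eq_bigr do rewrite dotpNl sinN mulrN; rewrite sumrN sqrrN.
Qed.

Lemma specE a xi : spec a xi =
  \sum_i \sum_j a i * a j * cos (dotp xi (y i - y j)).
Proof.
rewrite /spec !expr2 !mulr_suml -big_split; apply: eq_bigr => i _ /=.
rewrite !mulr_sumr -big_split; apply: eq_bigr => j _ /=.
by rewrite dotpBr cosB; ring.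
Qed.

(** The involution pairs each shift with its opposite, so the sum of the exponentials over the
    shifts is real. Multiplying the weights by it therefore amounts to summing the exponential sums
    at the shifted frequencies, and Cauchy-Schwarz applies to that sum. *)
Lemma spec_shift (J : finType) (t : J -> 'rV[R]_d) (s : J -> J) b xi :
  involutive s -> (forall j, t (s j) = - t j) ->
  spec (fun i => b i * \sum_j cos (dotp (t j) (y i))) xi <=
  #|J|%:R * \sum_j spec b (xi + t j).
Proof.
move=> sK ts.
have sin0 i : \sum_j sin (dotp (t j) (y i)) = 0.
  have : \sum_j sin (dotp (t j) (y i)) = - \sum_j sin (dotp (t j) (y i)).
    rewrite [LHS](reindex_inj (inv_inj sK)) -sumrN; apply: eq_bigr => j _.
    by rewrite ts dotpNl sinN.
  lra.
rewrite /spec big_split mulrDr; apply: lerD.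
  apply: le_trans (sqr_sum_le predT _); rewrite le_eqVlt; apply/orP; left.
  apply/eqP; congr (_ ^+ 2); rewrite exchange_big; apply: eq_bigr => i _ /=.
  rewrite -mulr_sumr -mulrA; congr (_ * _).
  under [in RHS]eq_bigr do rewrite dotpDl cosD.
  by rewrite sumrB -!mulr_sumr sin0 mulr0 subr0 mulrC.
apply: le_trans (sqr_sum_le predT _); rewrite le_eqVlt; apply/orP; left.
apply/eqP; congr (_ ^+ 2); rewrite exchange_big; apply: eq_bigr => i _ /=.
rewrite -mulr_sumr -mulrA; congr (_ * _).
under [in RHS]eq_bigr do rewrite dotpDl sinD.
by rewrite big_split -!mulr_sumr /= sin0 mulr0 addr0 mulrC.
Qed.

End spectrum.

(* The sum over the box is dominated by a sum with binomial weights, whose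
   Fourier transform is an explicit product of cosines; [p = 4 K ^ 2] makes these
   weights at least [1 / (8 K)] (relative to [4 ^ p]) up to distance [K] from
   their centre. *)
Lemma lattice_spec_le {R : realType} d (I : finType) (y : I -> 'rV[R]_d)
    (b : I -> R) (L K : nat) (p := (4 * K ^ 2)%N) :
  (forall i, 0 <= b i) -> (0 < L)%N -> (0 < K)%N ->
  (forall i j l, `|(y i - y j) ord0 l| <= 2 * L%:R) ->
  \sum_(k : {ffun 'I_d -> 'I_(p.*2).+1} |
        [forall l, (p - K <= k l <= p + K)%N])
     spec y b (\row_l (((k l)%:R - p%:R) / L%:R)) <=
  (8 * K%:R) ^+ d * \sum_i \sum_j b i * b j *
     \prod_l expR (- (cos 1 * (K%:R / L%:R * (y i - y j) ord0 l)) ^+ 2).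
Proof.
move=> b0 L0 K0 yL.
have L0' : 0 < L%:R :> R by rewrite ltr0n.
have p4 : 0 < 4 ^+ p :> R by rewrite exprn_gt0.
pose beta (k : 'I_(p.*2).+1) : R := 'C(p.*2, k)%:R.
apply: (@le_trans _ _ (\sum_(k : {ffun 'I_d -> 'I_(p.*2).+1})
    (\prod_l (8 * K%:R / 4 ^+ p * beta (k l))) *
    spec y b (\row_l (((k l)%:R - p%:R) / L%:R)))).
  rewrite [leRHS](bigID (fun k : {ffun 'I_d -> 'I_(p.*2).+1} =>
    [forall l, (p - K <= k l <= p + K)%N]))/=.
  apply: ler_wpDr.
    apply: sumr_ge0 => k _; rewrite mulr_ge0 ?spec_ge0//; apply: prodr_ge0 => l _.
    by rewrite mulr_ge0// divr_ge0 ?ltW// mulr_ge0.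
  apply: ler_sum => k /forallP pk; apply: ler_peMl; first exact: spec_ge0.
  have {1}<- : \prod_(l < d) (1 : R) = 1 by rewrite big1.
  apply: ler_prod => l _; rewrite ler01/= mulrAC ler_pdivlMr// mul1r /beta -natrX -!natrM ler_nat.
  exact: bin_lb.
under eq_bigr do rewrite big_split/= prodr_const card_ord -(mulrA (_ ^+ d)).
rewrite -mulr_sumr expr_div_n -mulrA; apply: ler_wpM2l.
  by rewrite exprn_ge0// mulr_ge0.
under eq_bigr => k _.
  rewrite specE mulr_sumr.
  under [\sum_i _]eq_bigr => i _ do rewrite mulr_sumr.
  over.
rewrite exchange_big mulr_sumr; apply: ler_sum => i _.
rewrite exchange_big mulr_sumr; apply: ler_sum => j _.
under eq_bigr => k _.
  rewrite mulrCA (_ : dotp _ _ = \sum_l ((k l)%:R - p%:R) * ((y i - y j) ord0 l / L%:R)).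
    over.
  by apply: eq_bigr => l _; rewrite !mxE mulrAC mulrA.
rewrite -mulr_sumr binomial_transform mulrCA; apply: ler_wpM2l.
  by rewrite mulr_ge0.
have -> : 4 ^+ p ^- d = \prod_(l < d) (4 ^+ p)^-1 :> R.
  by rewrite prodr_const card_ord exprVn.
rewrite -big_split; apply: ler_prod => l _ /=.
set v := (y i - y j) ord0 l.
have -> : (2 * cos (v / L%:R / 2)) ^+ p.*2 = 4 ^+ p * (cos (v / L%:R / 2) ^+ 2) ^+ p.
  by rewrite -mul2n exprM -exprMn; congr (_ ^+ _); ring.
rewrite mulKf ?gt_eqF// exprn_ge0 ?sqr_ge0//=.
(* The bound on [y] keeps the half phase v / (2L) in [-1, 1]; with [p = 4 K ^ 2] the exponent p (v /
   (2L))^2 becomes (K v / L)^2. *)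
apply: (@le_trans _ _ (expR (- (cos 1 * (v / L%:R / 2)) ^+ 2) ^+ p)).
  rewrite lerXn2r ?nnegrE ?sqr_ge0 ?expR_ge0//; apply: cos_sqr_le.
  rewrite -mulrA normrM -invfM normfV ler_pdivrMr ?normr_gt0 ?mulf_neq0 ?gt_eqF//.
  rewrite mul1r [leRHS]ger0_norm ?mulr_ge0// ?(ltW L0')// mulrC; exact: yL.
rewrite -expRM_natl ler_expR le_eqVlt; apply/orP; left; apply/eqP.
by rewrite /p natrM natrX; field; rewrite gt_eqF.
Qed.

Lemma sum_powR_le {R : realType} (e : R) n : 0 < e ->
  \sum_(1 <= r < n) r%:R `^ (- (1 + e)) <= 1 + e^-1.
Proof.
move=> e0.
(* The subtracted term is the tail of the integral of x^-(1+e); carrying it along makes the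
   induction close. *)
suff h m : \sum_(1 <= r < m.+2) r%:R `^ (- (1 + e)) <= 1 + e^-1 - m.+1%:R `^ (- e) / e.
  have e1 : 0 <= e^-1 by rewrite invr_ge0 ltW.
  case: n => [|[|n]]; [by rewrite big_geq// addr_ge0..|].
  apply: (le_trans (h n)); rewrite gerBl divr_ge0 ?powR_ge0//; exact: ltW.
elim: m => [|m IH].
  by rewrite big_nat1 !powR1; lra.
rewrite big_nat_recr//=; apply: (le_trans (lerD IH (lexx _))).
rewrite -addrA lerD2l -lerBrDl opprK.
set a : R := m.+2%:R; have a0 : 0 < a by rewrite ltr0n.
have m0 : 0 < m.+1%:R :> R by rewrite ltr0n.
(* 1 + e/a <= exp(1/a)^e <= (a / (a-1))^e, the last step because exp(-1/a) >= 1 - 1/a. *)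
have key : a `^ (- e) * (1 + e / a) <= m.+1%:R `^ (- e).
  have -> : m.+1%:R `^ (- e) = a `^ (- e) * (a / m.+1%:R) `^ e.
    rewrite powRM ?invr_ge0 ?ltW// mulrA -powRD; last by rewrite (gt_eqF a0) implybT.
    by rewrite addNr powRr0 mul1r -powR_inv1 ?ltW// -powRrM mulN1r.
  rewrite ler_wpM2l ?powR_ge0//; apply: le_trans (expR_ge1Dx _) _.
  have -> : expR (e / a) = expR a^-1 `^ e by rewrite -expRM mulrC.
  rewrite ge0_ler_powR ?nnegrE ?(ltW e0) ?expR_ge0 ?divr_ge0 ?(ltW a0) ?(ltW m0)//.
  rewrite -[leRHS]invrK invf_div -[leLHS]invrK -expRN lef_pV2 ?posrE ?expR_gt0 ?divr_gt0//.
  apply: le_trans (expR_ge1Dx _); rewrite le_eqVlt; apply/orP; left; apply/eqP.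
  by rewrite /a -[m.+2]addn1 natrD; field; rewrite -[1]/(1%:R) -natrD gt_eqF// ltr0n.
rewrite opprD powRD; last by rewrite (gt_eqF a0) implybT.
rewrite powR_inv1 ?(ltW a0)//.
have -> : a^-1 * a `^ (- e) = (a `^ (- e) * (1 + e / a) - a `^ (- e)) / e.
  by field; rewrite !gt_eqF.
by rewrite -mulNr -mulrDl ler_pM2r ?invr_gt0// addrC lerD2l.
Qed.

(** * Frostman weights and the large sieve *)

(** Sup-norm balls fit both the dyadic cubes and the coordinatewise products of Gaussians; Euclidean
    diameters return only in [dyadic_cube_diam]. *)
Definition near {R : realType} {d} (x p : 'rV[R]_d) (r : R) : bool :=
  [forall l, `|x ord0 l - p ord0 l| <= r].

Definition frostman {R : realType} {d} {I : finType} (y : I -> 'rV[R]_d)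
    (w : I -> R) (s C r0 : R) :=
  forall p r, r0 <= r -> \sum_(i | near (y i) p r) w i <= C * r `^ s.

Lemma frostman_mass_le {R : realType} d (I : finType) (y : I -> 'rV[R]_d) w s C r0 M :
  (forall i, 0 <= w i) -> (forall i l, `|y i ord0 l| <= M) -> r0 <= M ->
  frostman y w s C r0 -> \sum_i w i <= C * M `^ s.
Proof.
move=> w0 yM rM fr; apply: le_trans (fr 0 M rM).
rewrite [leRHS]big_mkcond; apply: ler_sum => i _; case: ifP => // /negP[].
by apply/forallP => l; rewrite mxE subr0.
Qed.

(** Take the least admissible [j]. If [j > 1], some coordinate exceeds (j-1)/m >= j/(2m), and its
    factor alone gives the decay through exp x >= x^(n+1) / (n+1)!; the other factors are at most 1,
    so [B] is independent of the dimension. The exponent [s + 2] leaves a summable j^-2 after a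
    Frostman bound of order j^s. *)
Lemma gauss_decay {R : realType} (kappa s : R) : 0 < kappa ->
  exists2 B : R, 0 < B & forall d (v : 'rV[R]_d) (m : nat), (0 < m)%N ->
    exists j : nat, [/\ (0 < j)%N, forall l, `|v ord0 l| <= j%:R / m%:R &
      \prod_l expR (- (kappa * (m%:R * v ord0 l)) ^+ 2) <= B * j%:R `^ (- (s + 2))].
Proof.
move=> k0; pose n := Num.truncn (s + 2).
pose B1 : R := (n.+1)`!%:R / ((kappa / 2) ^+ 2) ^+ n.+1.
have B10 : 0 < B1.
  by rewrite divr_gt0 ?ltr0n ?fact_gt0// !exprn_gt0// divr_gt0.
exists (1 + B1); first by rewrite addr_gt0.
move=> d v m m0; have m0' : 0 < m%:R :> R by rewrite ltr0n.
pose P j := (0 < j)%N && [forall l, `|v ord0 l| <= j%:R / m%:R].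
have exP : exists j, P j.
  exists (\sum_l Num.bound (`|v ord0 l| * m%:R)).+1; apply/forallP => l.
  rewrite ler_pdivlMr//; apply: le_trans (ltW (archi_boundP _)) _.
    by rewrite mulr_ge0 ?ler0n.
  by rewrite ler_nat (bigD1 l)//= leqW// leq_addr.
case: (ex_minnP exP) => j /andP[j0 /forallP vj] minj.
exists j; split => //.
case: j j0 vj minj => [//|[_ _ _|j _ _ minj]].
  rewrite powR1 mulr1; apply: (@le_trans _ _ 1); last by rewrite lerDl ltW.
  apply: prodr_ile1 => l _.
  by rewrite expR_ge0 /= -expR0 ler_expR oppr_le0 sqr_ge0.
have : ~~ P j.+1 by apply/negP => /minj; rewrite ltnn.
rewrite /P /= negb_forall => /existsP[l]; rewrite -ltNge => vl.
rewrite (bigD1 l)//= -[leRHS]mulr1; apply: ler_pM.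
- exact: expR_ge0.
- by apply: prodr_ge0 => i _; exact: expR_ge0.
- have j0 : 0 < (j.+2)%:R :> R by rewrite ltr0n.
  have vl' : j.+2%:R / 2 <= m%:R * `|v ord0 l|.
    move: vl; rewrite ltr_pdivrMr// mulrC => /ltW; apply: le_trans.
    by rewrite ler_pdivrMr// -natrM ler_nat; lia.
  set X := (_ ^+ 2).
  have X0 : 0 < (kappa / 2) ^+ 2 * j.+2%:R ^+ 2.
    by rewrite mulr_gt0 ?exprn_gt0// divr_gt0.
  have XX : (kappa / 2) ^+ 2 * j.+2%:R ^+ 2 <= X.
    rewrite /X -exprMn -[leRHS]real_normK ?num_real// lerXn2r ?nnegrE//.
      by rewrite mulr_ge0 ?divr_ge0 ?ltW.
    by rewrite !normrM (gtr0_norm k0) (gtr0_norm m0') mulrAC -mulrA ler_pM2l.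
  rewrite expRN -[leRHS]invrK lef_pV2 ?posrE ?expR_gt0 ?invr_gt0 ?mulr_gt0 ?addr_gt0 ?powR_gt0//.
  rewrite invfM powRN invrK.
  apply: (@le_trans _ _ (B1^-1 * j.+2%:R `^ (s + 2))).
    rewrite ler_wpM2r ?powR_ge0// lef_pV2 ?posrE ?addr_gt0//; lra.
  apply: (@le_trans _ _ (B1^-1 * (j.+2%:R ^+ 2) ^+ n.+1)).
    rewrite ler_pM2l ?invr_gt0// -exprM -powR_mulrn ?(ltW j0)// ler_powR ?ler1n//.
    apply: le_trans (ltW (truncnS_gt (s + 2))) _.
    by rewrite -/n ler_nat leq_pmull.
  apply: (@le_trans _ _ (X ^+ n.+1 / (n.+1)`!%:R)).
    rewrite /B1 invf_div mulrAC -exprMn ler_pM2r ?invr_gt0 ?ltr0n ?fact_gt0//.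
    by rewrite lerXn2r ?nnegrE ?sqr_ge0 ?(ltW X0).
  apply: le_trans (expR_ge1Dxn n (sqr_ge0 _)).
  by rewrite lerDr.
- apply: prodr_ile1 => i _.
  by rewrite expR_ge0 /= -expR0 ler_expR oppr_le0 sqr_ge0.
Qed.

(** The cube of radius k/m about [z] weighs at most C (k/m)^s, and the Gaussian there is of order
    k^-(s+2); the sum of k^-2 is at most 2. *)
Lemma gauss_sum_le {R : realType} (kappa s C : R) : 0 < kappa -> 0 <= C ->
  exists2 B : R, 0 <= B & forall d (I : finType) (y : I -> 'rV[R]_d) w r0 (m : nat) z,
    (forall i, 0 <= w i) -> (0 < m)%N -> r0 <= m%:R^-1 -> frostman y w s C r0 ->
    \sum_i w i * \prod_l expR (- (kappa * (m%:R * (z - y i) ord0 l)) ^+ 2) <=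
    B * m%:R `^ (- s).
Proof.
move=> k0 C0; have [B B0 decay] := gauss_decay s k0.
exists (B * C * 2) => [|d I y w r0 m z w0 m0 mr fr].
  by rewrite !mulr_ge0// ltW.
have m0' : 0 < m%:R :> R by rewrite ltr0n.
have /choice[j jP] i := decay d (z - y i) m m0.
pose N := (\max_i j i).+1.
(* Each point is charged to every radius whose cube contains it, not only to its own [j i]: an
   overcount that lets Frostman act on whole cubes once the sums are exchanged. *)
apply: (@le_trans _ _ (\sum_i w i * \sum_(1 <= k < N | near (y i) z (k%:R / m%:R))
   B * k%:R `^ (- (s + 2)))).
  apply: ler_sum => i _; apply: ler_wpM2l => //.
  have [j0 zj] := jP i; move/le_trans; apply.
  rewrite big_mkcond (bigD1_seq (j i)) ?iota_uniq//=; last first.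
    by rewrite mem_index_iota j0 ltnS leq_bigmax.
  case: ifP => [_|/negP[]]; last first.
    by apply/forallP => l; have := zj l; rewrite !mxE distrC.
  by rewrite lerDl; apply: sumr_ge0 => k _; case: ifP => // _; rewrite mulr_ge0 ?powR_ge0 ?ltW.
under eq_bigr => i _ do rewrite mulr_sumr.
under eq_bigr => i _ do rewrite big_mkcond.
rewrite exchange_big/=.
apply: (@le_trans _ _ (\sum_(1 <= k < N) B * C * m%:R `^ (- s) * k%:R `^ (- (1 + 1)))).
  rewrite big_nat [leRHS]big_nat; apply: ler_sum => k /andP[k0' _].
  have k0'' : 0 < k%:R :> R by rewrite ltr0n.
  rewrite -big_mkcond -mulr_suml/=.
  apply: (@le_trans _ _ (C * (k%:R / m%:R) `^ s * (B * k%:R `^ (- (s + 2))))).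
    apply: ler_wpM2r; first by rewrite mulr_ge0 ?powR_ge0 ?ltW.
    apply: fr; apply: (le_trans mr).
    by rewrite ler_peMl ?invr_ge0 ?(ltW m0')// ler1n.
  rewrite powRM ?invr_ge0 ?(ltW m0') ?(ltW k0'')// -[m%:R^-1]powR_inv1 ?(ltW m0')// -powRrM mulN1r.
  rewrite opprD powRD; last by rewrite (gt_eqF k0'') implybT.
  have kk : k%:R `^ s * k%:R `^ (- s) = 1 :> R.
    by rewrite -powRD ?subrr ?powRr0// (gt_eqF k0'') implybT.
  rewrite le_eqVlt; apply/orP; left; apply/eqP.
  transitivity (k%:R `^ s * k%:R `^ (- s) * (B * C * m%:R `^ (- s) * k%:R `^ (- 2))).
    by ring.
  by rewrite kk mul1r.
rewrite -mulr_sumr mulrAC ler_wpM2r ?powR_ge0//.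
rewrite ler_wpM2l ?mulr_ge0 ?(ltW B0)//.
by apply: le_trans (sum_powR_le _ ltr01) _; rewrite invr1.
Qed.

Lemma inord_inj {n : nat} (a b : nat) : (a < n.+1)%N -> (b < n.+1)%N ->
  inord a = inord b :> 'I_n.+1 -> a = b.
Proof. by move=> an bn /(congr1 val); rewrite /= !inordK. Qed.

Section shifts.
Context {R : realType} {d : nat}.

Definition shift_vec (L J : nat) (e : {ffun 'I_d -> 'I_(J.*2).+1}) : 'rV[R]_d :=
  \row_l (((e l)%:R - J%:R) / L%:R).

Lemma shift_vec_rev L J (e : {ffun 'I_d -> 'I_(J.*2).+1}) :
  shift_vec L [ffun l => rev_ord (e l)] = - shift_vec L e.
Proof.
apply/rowP => l; rewrite !mxE !ffunE /= subSS natrB ?leq_ord//.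
have -> : J.*2%:R = 2 * J%:R :> R by rewrite -mul2n natrM.
by rewrite -mulNr; congr (_ / _); ring.
Qed.

Lemma shift_vec_le L J (e : {ffun 'I_d -> 'I_(J.*2).+1}) l : (0 < L)%N ->
  `|shift_vec L e ord0 l| <= J%:R / L%:R.
Proof.
move=> L0; rewrite mxE normrM normfV (ger0_norm (ler0n _ L)).
rewrite ler_pM2r ?invr_gt0 ?ltr0n// ler_norml.
have : (e l)%:R <= (J.*2)%:R :> R by rewrite ler_nat -ltnS.
have -> : J.*2%:R = 2 * J%:R :> R by rewrite -mul2n natrM.
have := ler0n R (e l); lra.
Qed.

(* The points [m y + shift_vec L e] lie on the lattice [Z^d / L], and
   [lattice_index] is their position in a box centred at [p]. *)
Definition lattice_index (p J m : nat) (c : 'I_d -> int)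
    (e : {ffun 'I_d -> 'I_(J.*2).+1}) : {ffun 'I_d -> 'I_(p.*2).+1} :=
  [ffun l => inord `|(p%:Z + m%:Z * c l + (e l)%:Z - J%:Z)%R|%N].

Lemma lattice_indexE p J K m c (e : {ffun 'I_d -> 'I_(J.*2).+1}) l : (K <= p)%N ->
  (`|m%:Z * c l| + J%:Z <= K%:Z)%R ->
  (lattice_index p m c e l)%:Z = (p%:Z + m%:Z * c l + (e l)%:Z - J%:Z)%R.
Proof.
move=> Kp mcJ; rewrite ffunE inordK; have := ltn_ord (e l); lia.
Qed.

Lemma lattice_index_box p J K m c (e : {ffun 'I_d -> 'I_(J.*2).+1}) l :
  (K <= p)%N -> (`|m%:Z * c l| + J%:Z <= K%:Z)%R ->
  (p - K <= lattice_index p m c e l <= p + K)%N.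
Proof.
by move=> Kp mcJ; have := lattice_indexE e Kp mcJ; have := ltn_ord (e l); lia.
Qed.

End shifts.

(* With [b i = w i / S i], the exponential sum with weights [w] at [m y] is the
   average over small lattice shifts of the one with weights [b]. By Jensen and
   the Frostman condition, the sum over the points [m y] is then at most
   [C m ^ -s] times a sum over all lattice points of a box. *)
Lemma large_sieve {R : realType} (d M : nat) (s C : R) : (0 < M)%N -> 0 <= C ->
  exists2 B : R, 0 <= B & forall (I : finType) (y : I -> 'rV[R]_d) w (L m : nat),
    (forall i, 0 <= w i) -> (M <= L)%N -> (0 < m <= L)%N ->
    (forall i l, `|y i ord0 l| <= M%:R) ->
    (exists c : I -> 'I_d -> int, forall i l, y i ord0 l = (c i l)%:~R / L%:R) ->
    frostman y w s C L%:R^-1 ->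
    \sum_i w i * spec y w (m%:R *: y i) <= B * m%:R `^ (d%:R - 2 * s).
Proof.
move=> M0 C0; have M0' : 0 < M%:R :> R by rewrite ltr0n.
have c1 := @cos1_gt0 R.
have k0 : 0 < cos 1 * (2 * M%:R) :> R by rewrite !mulr_gt0.
have [B B0 gauss] := gauss_sum_le s k0 C0.
(* Shifts have coordinates at most J / L <= 1 / D, so the phases [dotp (t e) (y i)] are at most d M
   / D <= 1. *)
pose D := (d.+1 * M)%N.
pose W := C * M%:R `^ s; have W0 : 0 <= W by rewrite mulr_ge0 ?powR_ge0.
exists (C * W * B / cos 1 ^+ 2 * (16 * M%:R * D%:R) ^+ d).
  by rewrite !(mulr_ge0, exprn_ge0, invr_ge0, powR_ge0, ler0n) ?(ltW c1).
move=> I y w L m w0 ML /andP[m0 mL] yM [c yc] fr.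
have D0 : (0 < D)%N by rewrite muln_gt0.
have L0 : (0 < L)%N by exact: leq_trans ML.
have L0' : 0 < L%:R :> R by rewrite ltr0n.
have m0' : 0 < m%:R :> R by rewrite ltr0n.
(* The coordinates of [m y] are at most m M = K / (2L), so the box of radius K / L holds [m y]
   together with its shifts. If [L < D] then [J = 0] and the only shift is 0. *)
pose J := (L %/ D)%N; pose K := (2 * m * M * L)%N; pose p := (4 * K ^ 2)%N.
have K0 : (0 < K)%N by rewrite !muln_gt0 m0 M0 L0.
have Kp : (K <= p)%N by rewrite /p expnS mulnCA leq_pmulr// muln_gt0 expn_gt0 K0.
have JL : (J * D <= L)%N by exact: leq_trunc_div.
have LJ : (L <= J.*2.+1 * D)%N.
  have := ltn_ceil L D0; rewrite -/J => /ltnW/leq_trans; apply.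
  by rewrite leq_mul2r; apply/orP; right; lia.
have JL1 : J%:R / L%:R <= 1 :> R.
  rewrite ler_pdivrMr// mul1r ler_nat; apply: leq_trans JL; exact: leq_pmulr.
pose t : {ffun 'I_d -> 'I_(J.*2).+1} -> 'rV[R]_d :=
  @shift_vec R d L J.
pose N := #|{ffun 'I_d -> 'I_(J.*2).+1}|.
have NE : N%:R = J.*2.+1%:R ^+ d :> R.
  by rewrite /N card_ffun !card_ord natrX.
have N0 : 0 < N%:R :> R by rewrite NE exprn_gt0.
have mc i l : (`|m%:Z * c i l| + J%:Z <= K%:Z)%R.
  have ciL : (`|c i l| <= (M * L)%N%:Z)%R.
    have := yM i l; rewrite yc normrM normfV (ger0_norm (ler0n _ L)).
    by rewrite ler_pdivrMr// -intr_norm -natrM -(ler_int R).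
  have JL' : (J <= L)%N by apply: leq_trans JL; exact: leq_pmulr.
  have Lm : (L <= m * (M * L))%N by rewrite mulnA leq_pmull// muln_gt0 m0.
  have mciL : (`|m%:Z * c i l| <= (m * (M * L))%N%:Z)%R.
    by rewrite normrM PoszM ler_wpM2l.
  rewrite /K (_ : 2 * m * M * L = m * (M * L) + m * (M * L))%N; last by ring.
  by rewrite PoszD lerD// lez_nat (leq_trans JL').
pose S i := \sum_e cos (dotp (t e) (y i)).
have Sge i : cos 1 * N%:R <= S i.
  rewrite mulr_natr /N -sumr_const; apply: ler_sum => e _.
  apply: cos1_le_cos; apply: (le_trans (ler_norm_sum _ _ _)).
  apply: (@le_trans _ _ (\sum_(l < d) J%:R / L%:R * M%:R)).
    by apply: ler_sum => l _; rewrite normrM ler_pM// shift_vec_le.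
  rewrite sumr_const card_ord (_ : _ *+ d = (J * (M * d))%N%:R / L%:R); last first.
    by rewrite !natrM -(mulr_natr (_ * _)); ring.
  rewrite ler_pdivrMr// mul1r ler_nat; apply: leq_trans JL.
  by rewrite leq_mul2l mulnC leq_mul2r leqnSn !orbT.
have S0 i : 0 < S i by apply: lt_le_trans (Sge i); rewrite mulr_gt0.
pose b i := w i / S i.
have b0 i : 0 <= b i by rewrite divr_ge0// ltW.
have bw i : b i <= w i / (cos 1 * N%:R).
  by rewrite ler_wpM2l// lef_pV2 ?posrE// mulr_gt0.
pose xi (k : {ffun 'I_d -> 'I_(p.*2).+1}) : 'rV[R]_d :=
  \row_l (((k l)%:R - p%:R) / L%:R).
pose box (k : {ffun 'I_d -> 'I_(p.*2).+1}) :=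
  [forall l, (p - K <= k l <= p + K)%N].
pose k i e := lattice_index p m (c i) (e : {ffun 'I_d -> 'I_(J.*2).+1}).
have kE i e l : (k i e l)%:Z = (p%:Z + m%:Z * c i l + (e l)%:Z - J%:Z)%R.
  exact: lattice_indexE Kp (mc i l).
have k_inj i : injective (k i).
  move=> e e' kee; apply/ffunP => l; apply: val_inj => /=.
  by have := kE i e l; rewrite kee kE => /addIr/addrI[].
have k_box i e : box (k i e).
  by apply/forallP => l; exact: lattice_index_box Kp (mc i l).
have kxi i e : xi (k i e) = m%:R *: y i + t e.
  apply/rowP => l; rewrite !mxE yc mulrA -mulrDl; congr (_ / _).
  have := congr1 (fun z : int => z%:~R : R) (kE i e l).
  rewrite rmorphB !rmorphD rmorphM /= -!pmulrn => ->; ring.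
have step1 : \sum_i w i * spec y w (m%:R *: y i) <=
    N%:R * \sum_(q | box q) spec y b (xi q) * (C * m%:R `^ (- s)).
  apply: (@le_trans _ _ (\sum_i w i * (N%:R * \sum_e spec y b (xi (k i e))))).
    apply: ler_sum => i _; apply: ler_wpM2l => //.
    have -> : spec y w (m%:R *: y i) =
        spec y (fun i => b i * \sum_e cos (dotp (t e) (y i))) (m%:R *: y i).
      by congr spec; apply/funext => j; rewrite -/(S j) /b divfK ?gt_eqF.
    apply: (le_trans (@spec_shift _ _ _ y _ t
      (fun e => [ffun l => rev_ord (e l)]) b _ _ _)).
    - by move=> e; apply/ffunP => l; rewrite !ffunE rev_ordK.
    - by move=> e; exact: shift_vec_rev.
    - by rewrite -/N; under eq_bigr do rewrite -kxi.
  under eq_bigr do rewrite mulrCA.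
  rewrite -mulr_sumr ler_pM2l//.
  (* A lattice point reached from [i] is within J / L <= 1 of [m y i], so [y i] lies in the cube of
     radius 1 / m about [xi q / m]. By [k_inj], each [i] reaches a lattice point at most once. *)
  apply: (@le_trans _ _ (\sum_i \sum_(q | box q)
      if near (y i) (m%:R^-1 *: xi q) m%:R^-1 then w i * spec y b (xi q) else 0)).
    apply: ler_sum => i _; rewrite mulr_sumr.
    rewrite -(big_imset (fun q => w i * spec y b (xi q)))/=; last first.
      by move=> e e' _ _; exact: k_inj.
    rewrite -big_mkcondr/= big_mkcond [leRHS]big_mkcond; apply: ler_sum => q _.
    case: ifP => [/imsetP[e _ ->]|_]; last by case: ifP => // _; rewrite mulr_ge0 ?spec_ge0.
    rewrite k_box /=; case: ifP => // /negP[]; apply/forallP => l.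
    rewrite kxi !mxE mulrDr mulKf ?gt_eqF// opprD addNKr normrN normrM normfV.
    rewrite (gtr0_norm m0') ler_piMr ?invr_ge0 ?(ltW m0')//.
    by have := le_trans (shift_vec_le e l L0) JL1; rewrite mxE.
  rewrite exchange_big; apply: ler_sum => q _ /=.
  rewrite -big_mkcond -mulr_suml mulrC ler_wpM2l ?spec_ge0//.
  have -> : m%:R `^ (- s) = m%:R^-1 `^ s.
    by rewrite -[m%:R^-1]powR_inv1 ?(ltW m0')// -powRrM mulN1r.
  by apply: fr; rewrite lef_pV2 ?posrE// ler_nat.
have yyL i j l : `|(y i - y j) ord0 l| <= 2 * L%:R.
  rewrite !mxE; apply: (le_trans (ler_normB _ _)).
  apply: (le_trans (lerD (yM i l) (yM j l))).
  have : M%:R <= L%:R :> R by rewrite ler_nat.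
  lra.
have step2 := @lattice_spec_le R d I y b L K b0 L0 K0 yyL.
have W_ge : \sum_i w i <= W.
  apply: frostman_mass_le fr => //.
  by apply: (@le_trans _ _ 1); rewrite ?invf_le1 ?ler1n.
have step3 : \sum_i \sum_j b i * b j *
     \prod_l expR (- (cos 1 * (K%:R / L%:R * (y i - y j) ord0 l)) ^+ 2) <=
   (cos 1 * N%:R) ^- 2 * (W * (B * m%:R `^ (- s))).
  apply: (@le_trans _ _ (\sum_i \sum_j (cos 1 * N%:R) ^- 2 * (w i * (w j *
     \prod_l expR (- (cos 1 * (2 * M%:R) * (m%:R * (y i - y j) ord0 l)) ^+ 2))))).
    apply: ler_sum => i _; apply: ler_sum => j _.
    rewrite (mulrA (w i)) [leRHS]mulrA; apply: ler_pM.
    - exact: (mulr_ge0 (b0 i) (b0 j)).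
    - by apply: prodr_ge0 => l _; exact: expR_ge0.
    - apply: le_trans (ler_pM (b0 i) (b0 j) (bw i) (bw j)) _.
      by rewrite mulrACA -invfM -expr2 mulrC mulrA.
    - rewrite le_eqVlt; apply/orP; left; apply/eqP; apply: eq_bigr => l _.
      congr (expR (- _ ^+ 2)); rewrite /K !natrM; field.
      by rewrite gt_eqF.
  under eq_bigr => i _ do rewrite -mulr_sumr -mulr_sumr.
  rewrite -mulr_sumr ler_wpM2l ?invr_ge0 ?exprn_ge0 ?mulr_ge0 ?(ltW c1)//.
  apply: (@le_trans _ _ (\sum_i w i * (B * m%:R `^ (- s)))).
    apply: ler_sum => i _; apply: ler_wpM2l => //.
    by apply: gauss fr => //; rewrite lef_pV2 ?posrE// ler_nat.
  by rewrite -mulr_suml ler_wpM2r// mulr_ge0 ?powR_ge0.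
apply: (le_trans step1); rewrite -mulr_suml.
apply: (@le_trans _ _ (N%:R * ((8 * K%:R) ^+ d * ((cos 1 * N%:R) ^- 2 *
   (W * (B * m%:R `^ (- s)))) * (C * m%:R `^ (- s))))).
  rewrite ler_pM2l// ler_wpM2r ?mulr_ge0 ?powR_ge0//.
  apply: (le_trans step2); rewrite ler_wpM2l// exprn_ge0// mulr_ge0 ?ler0n//.
rewrite (_ : d%:R - 2 * s = d%:R + (- s + - s)); last by ring.
rewrite !powRD ?(gt_eqF m0') ?implybT// powR_mulrn ?ler0n//.
(* [L] cancels between [K] and [2 J + 1]: up to constants, the box has m^d times as many lattice
   points as there are shifts. *)
have ND : K%:R ^+ d / N%:R <= (2 * M%:R * D%:R) ^+ d * m%:R ^+ d :> R.
  rewrite NE -expr_div_n -exprMn lerXn2r ?nnegrE ?divr_ge0 ?mulr_ge0 ?ler0n//.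
  rewrite ler_pdivrMr ?ltr0n// -!natrM ler_nat /K.
  rewrite (_ : 2 * M * D * m * J.*2.+1 = 2 * m * M * (J.*2.+1 * D))%N; last by ring.
  by rewrite leq_mul2l LJ orbT.
rewrite (_ : 16 * M%:R * D%:R = 8 * (2 * M%:R * D%:R)); last by ring.
rewrite [(8 * K%:R) ^+ d]exprMn [(8 * _) ^+ d]exprMn.
set P := m%:R `^ _; set Q := C * W * B / cos 1 ^+ 2 * 8 ^+ d * P * P.
have Q0 : 0 <= Q.
  by rewrite !(mulr_ge0, exprn_ge0, invr_ge0, powR_ge0, ler0n) ?(ltW c1).
rewrite [leLHS](_ : _ = Q * (K%:R ^+ d / N%:R)); last first.
  by rewrite /Q; field; rewrite !gt_eqF.
rewrite [leRHS](_ : _ = Q * ((2 * M%:R * D%:R) ^+ d * m%:R ^+ d)); last first.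
  by rewrite /Q; field; rewrite !gt_eqF.
exact: ler_wpM2l.
Qed.

(** * Pinned dot products *)

Lemma sum_distn_le {R : realType} (a : nat -> R) (m L : nat) : (forall r, 0 <= a r) ->
  (m < L)%N -> \sum_(0 <= k < L) a `|m - k|%N <= 2 * \sum_(0 <= r < L) a r.
Proof.
move=> a0 mL; rewrite mulr2n mulrDl mul1r (big_cat_nat (n := m.+1))//=.
have sub n : (n <= L)%N -> \sum_(0 <= r < n) a r <= \sum_(0 <= r < L) a r.
  by move=> nL; rewrite [leRHS](big_cat_nat (n := n))//= lerDl sumr_ge0.
apply: lerD.
  apply: le_trans (sub m.+1 mL); rewrite big_nat_rev/= !big_nat.
  apply: ler_sum => k /andP[_ km]; rewrite le_eqVlt; apply/orP; left; apply/eqP.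
  by congr a; lia.
apply: le_trans (sub (L - m)%N (leq_subr _ _)).
rewrite -add1n big_addn [leRHS](big_ltn _)/= ?subn_gt0// big_nat [X in _ <= _ + X]big_nat.
apply: (@le_trans _ _ (\sum_(1 <= i < L - m | (1 <= i < L - m)%N) a i)).
  apply: ler_sum => k _; rewrite le_eqVlt; apply/orP; left; apply/eqP.
  by congr a; lia.
by rewrite -big_nat lerDr.
Qed.

Definition triple_strip {R : realType} {d} {I : finType} (y : I -> 'rV[R]_d)
    (w : I -> R) (L : nat) (i : I) : R :=
  \sum_j \sum_(k | `|dotp (y i) (y j - y k)| <= L%:R^-1) w j * w k.

(** The double sum over frequencies is a Fejer kernel, the squared modulus of the sum of exp(imu)
    over m < L. It is nonnegative for every pair, and on the strip all phases m u are at most 1, so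
    it is at least (cos 1 * L)^2 there. *)
Lemma triple_strip_spec {R : realType} d (I : finType) (y : I -> 'rV[R]_d) w L i :
  (forall i, 0 <= w i) -> (0 < L)%N ->
  (cos 1 * L%:R) ^+ 2 * triple_strip y w L i <=
  \sum_(0 <= m < L) \sum_(0 <= k < L) spec y w (`|m - k|%N%:R *: y i).
Proof.
move=> w0 L0; have L0' : 0 < L%:R :> R by rewrite ltr0n.
have specE' (m k : nat) : spec y w (`|m - k|%N%:R *: y i) = \sum_j \sum_l w j * w l *
    cos ((m%:R - k%:R) * dotp (y i) (y j - y l)).
  have -> : spec y w (`|m - k|%N%:R *: y i) = spec y w ((m%:R - k%:R) *: y i).
    have [km|/ltnW mk] := leqP k m.
      by rewrite distnEl// natrB.
    by rewrite distnEr// natrB// -[in RHS]opprB scaleNr specN.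
  rewrite specE; apply: eq_bigr => j _; apply: eq_bigr => l _.
  by rewrite dotpZl.
have -> : \sum_(0 <= m < L) \sum_(0 <= k < L) spec y w (`|m - k|%N%:R *: y i) =
   \sum_j \sum_l w j * w l * ((\sum_(0 <= m < L) cos (m%:R * dotp (y i) (y j - y l))) ^+ 2
     + (\sum_(0 <= m < L) sin (m%:R * dotp (y i) (y j - y l))) ^+ 2).
  under eq_bigr => m _ do under eq_bigr => k _ do rewrite specE'.
  under eq_bigr => m _ do rewrite exchange_big.
  rewrite exchange_big; apply: eq_bigr => j _.
  under eq_bigr => m _ do rewrite exchange_big.
  rewrite exchange_big; apply: eq_bigr => l _ /=.
  move: (dotp _ _) => u; rewrite !expr2 !mulr_suml -big_split mulr_sumr; apply: eq_bigr => m _ /=.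
  rewrite !mulr_sumr -big_split mulr_sumr; apply: eq_bigr => k _ /=.
  by rewrite mulrBl cosB.
rewrite /triple_strip mulr_sumr; apply: ler_sum => j _.
rewrite mulr_sumr big_mkcond; apply: ler_sum => l _.
case: ifP => [u|_]; last by rewrite mulr_ge0 ?mulr_ge0// addr_ge0 ?sqr_ge0.
rewrite mulrC ler_wpM2l ?mulr_ge0//.
apply: ler_wpDr; first exact: sqr_ge0.
have c1 := @cos1_gt0 R.
have H : cos 1 * L%:R <= \sum_(0 <= m < L) cos (m%:R * dotp (y i) (y j - y l)).
  rewrite mulr_natr -[X in _ *+ X]subn0 -sumr_const_nat big_nat [leRHS]big_nat.
  apply: ler_sum => m /andP[_ mL]; apply: cos1_le_cos.
  rewrite normrM normr_nat -[leRHS](mulfV (lt0r_neq0 L0')); apply: ler_pM => //.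
  by rewrite ler_nat ltnW.
have cL : 0 <= cos 1 * L%:R :> R by rewrite mulr_ge0 ?(ltW c1).
by rewrite lerXn2r ?nnegrE// (le_trans cL H).
Qed.

Lemma triple_strip_sum {R : realType} (d M : nat) (s C : R) :
  (0 < M)%N -> 0 <= C -> d.+1%:R / 2 < s ->
  exists2 B : R, 0 < B & forall (I : finType) (y : I -> 'rV[R]_d) w (L : nat),
    (forall i, 0 <= w i) -> (M <= L)%N ->
    (forall i l, `|y i ord0 l| <= M%:R) ->
    (exists c : I -> 'I_d -> int, forall i l, y i ord0 l = (c i l)%:~R / L%:R) ->
    frostman y w s C L%:R^-1 ->
    \sum_i w i * triple_strip y w L i <= B / L%:R.
Proof.
move=> M0 C0 ds.
have [B B0 sieve] := large_sieve d s M0 C0.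
have c1 := @cos1_gt0 R.
pose e := 2 * s - d.+1%:R; have e0 : 0 < e by rewrite /e; lra.
pose W := C * M%:R `^ s; have W0 : 0 <= W by rewrite mulr_ge0 ?powR_ge0.
(* [W ^+ 3] pays for frequency 0, outside the range of the sieve, where [spec] is the squared total
   mass; the other term pays for the sum of r^-(1+e). *)
pose Q := W ^+ 3 + B * (1 + e^-1).
have Q0 : 0 <= Q by rewrite !(addr_ge0, mulr_ge0, exprn_ge0)// invr_ge0 ltW.
exists (2 * Q / cos 1 ^+ 2 + 1).
  by rewrite ltr_wpDl// !(mulr_ge0, invr_ge0, exprn_ge0)// ltW.
move=> I y w L w0 ML yM yc fr.
have L0 : (0 < L)%N by exact: leq_trans ML.
have L0' : 0 < L%:R :> R by rewrite ltr0n.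
have cL0 : 0 < (cos 1 * L%:R) ^+ 2 :> R by rewrite exprn_gt0// mulr_gt0.
have W_ge : \sum_i w i <= W.
  apply: frostman_mass_le fr => //.
  by apply: (@le_trans _ _ 1); rewrite ?invf_le1 ?ler1n.
have Sw0 : 0 <= \sum_i w i by exact: sumr_ge0.
pose a (r : nat) := \sum_i w i * spec y w (r%:R *: y i).
have a0 r : 0 <= a r by apply: sumr_ge0 => i _; rewrite mulr_ge0 ?spec_ge0.
have sum_a : \sum_(0 <= r < L) a r <= Q.
  rewrite big_ltn//; apply: lerD.
    apply: (@le_trans _ _ ((\sum_i w i) ^+ 3)); last by rewrite lerXn2r.
    rewrite /a [in leRHS]exprS mulr_suml; apply: ler_sum => i _.
    rewrite ler_wpM2l// scale0r /spec.
    have dot0 j : dotp 0 (y j) = 0 by rewrite -(scale0r 0) dotpZl mul0r.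
    under eq_bigr do rewrite dot0 cos0 mulr1.
    under [X in _ + X ^+ 2]eq_bigr do rewrite dot0 sin0 mulr0.
    by rewrite [X in _ + X ^+ 2]big1// expr0n addr0.
  apply: (@le_trans _ _ (\sum_(1 <= r < L) B * r%:R `^ (- (1 + e)))).
    rewrite big_nat [leRHS]big_nat; apply: ler_sum => r /andP[r0 rL].
    have -> : - (1 + e) = d%:R - 2 * s by rewrite /e -natr1; ring.
    by apply: (sieve I y w L r w0 ML _ yM yc fr); rewrite r0/= ltnW.
  by rewrite -mulr_sumr ler_wpM2l// sum_powR_le.
have main : (cos 1 * L%:R) ^+ 2 * \sum_i w i * triple_strip y w L i <= L%:R * (2 * Q).
  apply: (@le_trans _ _ (\sum_(0 <= m < L) \sum_(0 <= k < L) a `|m - k|%N)).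
    under [leRHS]eq_bigr => m _ do rewrite exchange_big.
    rewrite exchange_big mulr_sumr; apply: ler_sum => i _ /=.
    under eq_bigr => m _ do rewrite -mulr_sumr.
    by rewrite -mulr_sumr mulrCA ler_wpM2l// triple_strip_spec.
  rewrite -[X in X%:R * _]subn0 mulr_natl -sumr_const_nat big_nat [leRHS]big_nat.
  apply: ler_sum => m /andP[_ mL]; apply: le_trans (sum_distn_le a0 mL) _.
  by rewrite ler_pM2l.
rewrite -(ler_pM2l cL0); apply: (le_trans main).
apply: (@le_trans _ _ ((cos 1 * L%:R) ^+ 2 * (2 * Q / cos 1 ^+ 2 / L%:R))).
  by rewrite le_eqVlt; apply/orP; left; apply/eqP; field; rewrite !gt_eqF.
by rewrite ler_pM2l// ler_pM2r ?invr_gt0// lerDl.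
Qed.

Lemma representatives (I : finType) (T : eqType) (f : I -> T) (A : {set I}) :
  exists rep : I -> I, {in A, forall x, rep x \in A /\ f (rep x) = f x} /\
    {in A &, forall x x', f x = f x' -> rep x = rep x'}.
Proof.
(* [pick] sees [x] only through [f x], so equal values get equal representatives; the default is
   reached only outside [A]. *)
exists (fun x => odflt x [pick z in A | f z == f x]); split=> [x xA|x x' xA x'A ff].
  by case: pickP => [z /andP[zA /eqP]//|_].
rewrite ff; case: pickP => // /(_ x').
by rewrite x'A eqxx.
Qed.

(** Cauchy-Schwarz over the classes of [f]: the squared masses of the classes add up to the weight
    of the pairs that share a class. *)
Lemma sqr_sum_le_classes {R : realType} (I : finType) (T : eqType) (f : I -> T)
    (A : {set I}) (w : I -> R) :
  exists P : {set I}, [/\ P \subset A, {in P &, injective f} &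
    (\sum_(i in A) w i) ^+ 2 <=
      #|P|%:R * \sum_(i in A) \sum_(j in A | f j == f i) w i * w j].
Proof.
have [rep [repA rep_eq]] := representatives f A.
exists (rep @: A); split.
- by apply/fintype.subsetP => _ /imsetP[x xA ->]; exact: (repA x xA).1.
- move=> _ _ /imsetP[x xA ->] /imsetP[z zA ->].
  by rewrite (repA x xA).2 (repA z zA).2; exact: rep_eq.
have part (F : I -> R) : \sum_(i in A) F i =
    \sum_(r in rep @: A) \sum_(i in A | rep i == r) F i.
  by apply: partition_big => i iA; exact: imset_f.
rewrite [in leLHS]part; apply: (le_trans (sqr_sum_le _ _)).
rewrite ler_wpM2l// [leRHS]part; apply: ler_sum => r _.
rewrite expr2 mulr_suml; apply: ler_sum => i /andP[iA /eqP ir].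
rewrite mulr_sumr le_eqVlt; apply/orP; left; apply/eqP; apply: eq_bigl => j.
case jA : (j \in A) => //=; apply/eqP/eqP => [jr|/rep_eq->//].
by rewrite -(repA j jA).2 jr -ir (repA i iA).2.
Qed.

Definition dot_cell {R : realType} {d} {I : finType} (y : I -> 'rV[R]_d)
    (L : nat) (i j : I) : int := Num.floor (L%:R * dotp (y i) (y j)).

(** Classes are formed among the points of [G] only, so [P] lies in [G] and the property can be used
    again at each of its points. Positivity of [w] on [G] later supplies nearby points of [E]. *)
Lemma pinned_cells {R : realType} (d M : nat) (s C c0 : R) :
  (0 < M)%N -> 0 <= C -> d.+1%:R / 2 < s -> 0 < c0 ->
  exists2 kappa : R, 0 < kappa & forall (I : finType) (y : I -> 'rV[R]_d) w (L : nat),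
    (forall i, 0 <= w i) -> (M <= L)%N ->
    (forall i l, `|y i ord0 l| <= M%:R) ->
    (exists c : I -> 'I_d -> int, forall i l, y i ord0 l = (c i l)%:~R / L%:R) ->
    frostman y w s C L%:R^-1 -> c0 <= \sum_i w i ->
    exists G : {set I}, [/\ (0 < #|G|)%N, {in G, forall i, 0 < w i} &
      {in G, forall i, exists P : {set I}, [/\ P \subset G,
        {in P &, injective (dot_cell y L i)} & kappa * L%:R <= #|P|%:R]}].
Proof.
move=> M0 C0 ds c00; have [B B0 trip] := triple_strip_sum M0 C0 ds.
exists (c0 ^+ 3 / (8 * B)); first by rewrite divr_gt0 ?exprn_gt0 ?mulr_gt0.
move=> I y w L w0 ML yM yc fr cw.
have L0 : (0 < L)%N by exact: leq_trans ML.
have L0' : 0 < L%:R :> R by rewrite ltr0n.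
(* Chebyshev threshold: points of positive weight outside [G] weigh at most [c0 / 2] in all. Then
   (c0/2)^2 / tau is kappa * L. *)
pose tau := 2 * B / (c0 * L%:R).
have tau0 : 0 < tau by rewrite divr_gt0 ?mulr_gt0.
have T0 i : 0 <= triple_strip y w L i.
  by apply: sumr_ge0 => j _; apply: sumr_ge0 => k _; rewrite mulr_ge0.
pose G := [set i | (0 < w i) && (triple_strip y w L i <= tau)]%SET.
have wG : c0 / 2 <= \sum_(i in G) w i.
  have : \sum_i w i <= \sum_(i in G) w i + tau^-1 * \sum_i w i * triple_strip y w L i.
    rewrite [X in X + _]big_mkcond mulr_sumr -big_split; apply: ler_sum => i _ /=.
    case: ifP => [_|/negP iG].
      by rewrite lerDl !mulr_ge0 ?invr_ge0 ?(ltW tau0).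
    have [wi|wi] := ltP 0 (w i); last first.
      have -> : w i = 0 by apply/le_anti; rewrite wi w0.
      by rewrite mul0r mulr0 addr0.
    rewrite add0r mulrCA ler_peMr// mulrC ler_pdivlMr// mul1r.
    by rewrite leNgt; apply/negP => /ltW Ti; apply: iG; rewrite inE wi Ti.
  have tauB : tau^-1 * (B / L%:R) = c0 / 2.
    by rewrite /tau; field; rewrite !gt_eqF.
  move=> /(le_trans cw)/le_trans/(_ (lerD (lexx _) (ler_wpM2l _ (trip _ _ _ _ w0 ML yM yc fr)))).
  rewrite tauB invr_ge0 (ltW tau0) => /(_ isT); lra.
exists G; split.
- rewrite lt0n; apply/negP => /eqP/card0_eq G0; move: wG.
  by rewrite big1 ?leNgt ?divr_gt0// => i; rewrite G0.
- by move=> i; rewrite inE => /andP[].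
move=> i; rewrite inE => /andP[_ Ti].
have [P [PG Pinj PS]] := sqr_sum_le_classes (dot_cell y L i) G w.
exists P; split=> //.
(* Values in one cell differ by less than 1 / L, so pairs sharing a class are among those that
   [triple_strip] counts. *)
have strip : \sum_(j in G) \sum_(k in G | dot_cell y L i k == dot_cell y L i j) w j * w k
    <= tau.
  apply: le_trans Ti; rewrite big_mkcond; apply: ler_sum => j _.
  case: ifP => _; last by apply: sumr_ge0 => k _; rewrite mulr_ge0.
  rewrite big_mkcond [leRHS]big_mkcond; apply: ler_sum => k _.
  case: ifP => [/andP[_ /eqP jk]|_]; last by case: ifP => // _; rewrite mulr_ge0.
  rewrite ifT// -(ler_pM2l L0') mulfV ?gt_eqF// -[X in X * `|_|]gtr0_norm// -normrM.
  rewrite dotpBr mulrBr.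
  have /andP[] := floor_itv (L%:R * dotp (y i) (y j)).
  have /andP[] := floor_itv (L%:R * dotp (y i) (y k)).
  move: jk; rewrite /dot_cell => ->; rewrite intrD ler_norml; lra.
have := le_trans PS (ler_wpM2l (ler0n _ _) strip).
have c2 : (c0 / 2) ^+ 2 <= (\sum_(i in G) w i) ^+ 2.
  have c20 : 0 <= c0 / 2 by rewrite divr_ge0// ltW.
  by rewrite lerXn2r ?nnegrE// (le_trans c20).
move=> /(le_trans c2); rewrite -ler_pdivrMr//; apply: le_trans.
by rewrite le_eqVlt; apply/orP; left; apply/eqP; rewrite /tau; field; rewrite !gt_eqF.
Qed.

(** * Growing the tree *)

Lemma crossing_edge (V : finType) (e : rel V) (S : {set V}) u v :
  connect e u v -> u \in S -> v \notin S ->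
  exists a b, [/\ e a b, a \in S & b \notin S].
Proof.
case/connectP => p; elim: p u => [|w p IH] u /=; first by move=> _ -> ->.
case/andP=> euw ewp vE uS vS; case wS: (w \in S); first exact: IH ewp vE wS vS.
by exists u, w; rewrite wS.
Qed.

Section tree_growth.
Context {R : realType} {k : nat} {I : finType} {Z : eqType}.
Variables (T : rel 'I_k.+1) (q : I -> I -> Z) (G : {set I}) (D : R).
Hypotheses (T_conn : connected_graph T) (T_sym : symmetric T)
  (q_sym : forall a b, q a b = q b a) (G0 : (0 < #|G|)%N) (D0 : 0 <= D)
  (G_pinned : {in G, forall a, exists P : {set I},
    [/\ P \subset G, {in P &, injective (q a)} & D <= #|P|%:R]}).

Let config := {ffun 'I_k.+1 -> I}.

Let separated (F : {set 'I_k.+1 * 'I_k.+1}) (x x' : config) : Prop :=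
  {in F, forall p, q (x p.1) (x p.2) = q (x' p.1) (x' p.2)} -> x = x'.

(** Configurations are total functions: vertices not yet placed keep one common initial value, so
    agreement on [F] can be required to force equality everywhere. *)
Let partial_configs (S : {set 'I_k.+1}) (F : {set 'I_k.+1 * 'I_k.+1})
    (X : {set config}) : Prop :=
  [/\ F \subset edges T, {in F, forall p, (p.1 \in S) && (p.2 \in S)},
      {in X, forall (x : config) v, x v \in G}, {in X &, forall x x', separated F x x'} &
      D ^+ #|F| <= #|X|%:R].

(** Connectivity gives an edge from some [u] in [S] to a new [v], which receives the values in
    [P (x u)]. Edges of [F] avoid [v], so agreement on them recovers the old configuration;
    agreement on the new edge then recovers the value at [v], by injectivity on [P (x u)]. *)
Let extend (S : {set 'I_k.+1}) F X : partial_configs S F X ->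
  (0 < #|S|)%N -> (#|S| < k.+1)%N ->
  exists S' F' X', [/\ partial_configs S' F' X', #|S'| = #|S|.+1 & #|F'| = #|F|.+1].
Proof.
move=> [FT FS XG Xsep DX] /card_gt0P[r rS] Sk.
have [v0 v0S] : exists v, v \notin S.
  apply/existsP; rewrite -negb_forall; apply/negP => /forallP allS.
  move: Sk; rewrite (_ : #|S| = k.+1) ?ltnn//.
  by rewrite -[RHS]card_ord; apply: eq_card => v; rewrite allS.
have [u [v [uv uS vS]]] := crossing_edge (T_conn r v0) rS v0S.
have uNv : u != v by apply: contraNneq vS => <-.
pose p := if (u < v)%N then (u, v) else (v, u).
have pT : p \in edges T.
  rewrite inE /p; case: (ltnP u v) => /= [->//|vu].
  by rewrite T_sym uv andbT ltn_neqAle vu andbT eq_sym.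
have pq (x : config) : q (x p.1) (x p.2) = q (x u) (x v).
  by rewrite /p; case: ifP.
have pF : p \notin F.
  by apply/negP => /FS; rewrite /p; case: ifP => _ /=; rewrite (negbTE vS) ?andbF.
have /choice[P PG] a : exists P : {set I}, a \in G ->
    [/\ P \subset G, {in P &, injective (q a)} & D <= #|P|%:R].
  case aG: (a \in G); last by exists G.
  by have [P PP] := G_pinned aG; exists P.
pose upd (z : config * I) : config := [ffun w => if w == v then z.2 else z.1 w].
pose A := [set z : config * I | (z.1 \in X) && (z.2 \in P (z.1 u))]%SET.
have updv z : upd z v = z.2 by rewrite ffunE eqxx.
have updS z w : w \in S -> upd z w = z.1 w.
  by rewrite ffunE; case: eqP => // -> vS'; rewrite vS' in vS.
have upd_sep z z' : z \in A -> z' \in A ->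
    {in p |: F, forall p, q (upd z p.1) (upd z p.2) = q (upd z' p.1) (upd z' p.2)} ->
    z = z'.
  case: z z' => [x y] [x' y']; rewrite !inE /= => /andP[xX yP] /andP[x'X y'P] agree.
  have xx' : x = x'.
    apply: Xsep => // f fF; have /andP[f1 f2] := FS f fF.
    by have := agree f; rewrite !updS//= !inE fF orbT; apply.
  subst x'; congr pair.
  have [_ + _] := PG (x u) (XG x xX u); apply=> //.
  by have := agree p; rewrite !pq !updv !updS//= !inE eqxx; apply.
exists (v |: S), (p |: F), (upd @: A); split; last 2 first.
- by rewrite cardsU1 vS.
- by rewrite cardsU1 pF.
split.
- by apply/fintype.subsetP => f /setU1P[->//|]; exact: (fintype.subsetP FT).
- move=> f /setU1P[->|/FS/andP[f1 f2]]; last by rewrite !inE f1 f2 !orbT.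
  by rewrite /p; case: ifP => _; rewrite !inE /= eqxx uS ?orbT.
- move=> _ /imsetP[[x y]] /[!inE] /= /andP[xX yP] -> w; rewrite ffunE.
  case: ifP => _; last exact: XG.
  by have [PsG _ _] := PG (x u) (XG x xX u); exact: (fintype.subsetP PsG).
- by move=> _ _ /imsetP[z zA ->] /imsetP[z' z'A ->] /(upd_sep _ _ zA z'A) ->.
rewrite cardsU1 pF exprS card_in_imset; last first.
  by move=> z z' zA z'A zz'; apply: upd_sep => // f _; rewrite zz'.
have -> : #|A| = (\sum_(x in X) #|P (x u)|)%N.
  rewrite -sum1_card; under [RHS]eq_bigr do rewrite -sum1_card.
  by rewrite pair_big_dep; apply: eq_bigl => z; rewrite inE.
rewrite natr_sum; apply: (@le_trans _ _ (\sum_(x in X) D)).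
  by rewrite sumr_const -mulr_natr ler_wpM2l.
by apply: ler_sum => x xX; have [_ _] := PG (x u) (XG x xX u).
Qed.

Lemma tree_growth : #|edges T| = k -> exists X : {set config},
  [/\ {in X, forall (x : config) v, x v \in G}, {in X &, forall x x', separated (edges T) x x'} &
      D ^+ k <= #|X|%:R].
Proof.
move=> Tk.
have : exists S F X, [/\ partial_configs S F X, #|S| = k.+1 & #|F| = k].
  suff h j : (j <= k)%N ->
    exists S F X, [/\ partial_configs S F X, #|S| = j.+1 & #|F| = j] by exact: h.
  elim: j => [_|j IH jk].
    have /card_gt0P[g gG] := G0.
    exists [set ord0]%SET, finset.set0, [set [ffun=> g]]%SET.
    rewrite !cards1 cards0; split=> //; split.
    - exact: finset.sub0set.
    - by move=> p; rewrite inE.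
    - by move=> x /set1P -> v; rewrite ffunE.
    - by move=> x x' /set1P -> /set1P ->.
    - by rewrite cards0 cards1 expr0.
  have [S [F [X [SFX Sj Fj]]]] := IH (ltnW jk).
  have [||S' [F' [X' [? Sj' Fj']]]] := extend SFX; rewrite ?Sj//.
  by exists S', F', X'; rewrite Sj' Fj' Sj Fj.
case=> S [F [X [[FT _ XG Xsep DX] _ Fk]]].
have FE : F = edges T by apply/eqP; rewrite eqEcard FT Tk Fk leqnn.
by exists X; split=> //; [rewrite -FE|rewrite -[X in _ ^+ X]Fk].
Qed.

End tree_growth.

(** * The discrete Frostman lemma *)

Section saturated_weights.
Context {R : realType} {I : finType} {T : eqType}.
Variables (anc : nat -> I -> T) (b : nat -> R) (A : {set I}) (n : nat).
Hypotheses (b_gt0 : forall j, 0 < b j) (anc_inj : injective (anc n))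
  (anc_refine : forall j x x', (j < n)%N ->
     anc j.+1 x = anc j.+1 x' -> anc j x = anc j x').

Let mass (w : I -> R) j x := \sum_(x' | anc j x' == anc j x) w x'.

Let anc_le j k x x' : (j <= k <= n)%N -> anc k x = anc k x' -> anc j x = anc j x'.
Proof.
elim: k => [|k IH] /andP[jk kn]; first by move: jk; rewrite leqn0 => /eqP ->.
move: jk; rewrite leq_eqVlt ltnS => /orP[/eqP -> //|jk] /(anc_refine kn).
by apply: IH; rewrite jk ltnW.
Qed.

(* Starting from weight [b n] on every cell of [A], scale down, level by level
   from the finest one, each cell that carries too much mass: afterwards every
   point of [A] lies in a cell where the bound is attained. *)
Lemma saturated_weights k : (k <= n)%N -> exists w : I -> R,
  [/\ forall x, 0 <= w x, forall x, 0 < w x -> x \in A,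
      forall j x, (k <= j <= n)%N -> mass w j x <= b j &
      forall x, x \in A -> exists2 j, (k <= j <= n)%N & mass w j x = b j].
Proof.
move=> kn; rewrite -(subKn kn); move: (n - k)%N (leq_subr k n) => {kn k}t.
elim: t => [_|t IH tn].
  rewrite subn0; exists (fun x => if x \in A then b n else 0).
  have massn x : mass (fun x => if x \in A then b n else 0) n x =
      if x \in A then b n else 0.
    rewrite /mass (eq_bigl (pred1 x)) ?big_pred1_eq// => x'.
    exact: (inj_eq anc_inj).
  split=> [x|x|j x|x xA].
  - by case: ifP => // _; exact: ltW.
  - by case: ifP => //; rewrite ltxx.
  - by rewrite -eqn_leq => /eqP <-; rewrite massn; case: ifP => // _; exact: ltW.
  - by exists n; rewrite ?leqnn// massn xA.
have [w [w0 wA wb wsat]] := IH (ltnW tn).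
set k := (n - t.+1)%N; have kS : (n - t = k.+1)%N by rewrite /k; lia.
rewrite kS in wb wsat.
(* [f] is constant on cells of level [k], so it scales the mass of every finer cell by one factor at
   most 1. A point where [f] is 1 keeps its saturated level; elsewhere level [k] becomes
   saturated. *)
pose f x := if mass w k x <= b k then 1 else b k / mass w k x.
have mass0 j x : 0 <= mass w j x by exact: sumr_ge0.
have f_ge0 x : 0 <= f x by rewrite /f; case: ifP => // _; rewrite divr_ge0// ltW.
have f_le1 x : f x <= 1.
  rewrite /f; case: ifP => // /negbT; rewrite -ltNge => bS.
  by rewrite ler_pdivrMr ?mul1r ?ltW// (lt_trans _ bS).
have f_anc x x' : anc k x = anc k x' -> f x = f x' by rewrite /f /mass => ->.
have massf j x : (k <= j <= n)%N -> mass (fun x => w x * f x) j x = mass w j x * f x.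
  move=> kj; rewrite /mass mulr_suml; apply: eq_bigr => x' /eqP xx'.
  by congr (_ * _); apply: f_anc; exact: anc_le xx'.
exists (fun x => w x * f x); split=> [x|x|j x kj|x xA].
- by rewrite mulr_ge0.
- move=> wf; apply: wA; rewrite lt_neqAle w0 andbT.
  by apply: contraTneq wf => <-; rewrite mul0r ltxx.
- rewrite massf//; case/andP: kj => + jn; rewrite leq_eqVlt => /orP[/eqP <-|kj].
    rewrite /f; case: ifP => [|/negbT]; first by rewrite mulr1.
    by rewrite -ltNge => bS; rewrite mulrC divfK// gt_eqF// (lt_trans _ bS).
  by apply: le_trans (wb j x _); rewrite ?kj// ler_piMr.
case: (lerP (mass w k x) (b k)) => bS.
  have [j /andP[kj jn] jsat] := wsat x xA; exists j; first by rewrite jn ltnW.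
  by rewrite massf ?jn ?(ltnW kj)// jsat /f bS mulr1.
exists k; first by rewrite leqnn leq_subr.
rewrite massf ?leqnn ?leq_subr// /f leNgt bS /= mulrC divfK//.
by rewrite gt_eqF// (lt_trans _ bS).
Qed.

(** Each point of [A] selects its coarsest saturated cell. Selected cells that meet are nested,
    hence equal by minimality, so their bounds [b] add up to at most the total mass. They cover [A],
    which turns a lower bound for covers into one for that mass. *)
Lemma frostman_weights k : (k <= n)%N -> exists w : I -> R,
  [/\ forall x, 0 <= w x, forall x, 0 < w x -> x \in A,
      forall j x, (k <= j <= n)%N -> \sum_(x' | anc j x' == anc j x) w x' <= b j &
      exists (P : {set I}) (lev : I -> nat),
        [/\ {in P, forall x, (k <= lev x <= n)%N},
            {in A, forall x, exists2 r, r \in P & anc (lev r) x = anc (lev r) r} &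
            \sum_(r in P) b (lev r) <= \sum_x w x]].
Proof.
move=> kn; have [w [w0 wA wb wsat]] := saturated_weights kn.
exists w; split=> //.
have /choice[lev levP] x : exists j, x \in A -> [/\ (k <= j <= n)%N, mass w j x = b j &
    forall i, (k <= i <= n)%N -> mass w i x = b i -> (j <= i)%N].
  case xA: (x \in A); last by exists 0%N.
  have ex : exists j, (k <= j <= n)%N && (mass w j x == b j).
    by have [j kj /eqP E] := wsat x xA; exists j; rewrite kj.
  case: (ex_minnP ex) => j /andP[kj /eqP E] minj; exists j => _; split=> // i ki Ei.
  by apply: minj; rewrite ki Ei eqxx.
pose label x := (lev x, anc (lev x) x).
have [rep [repA rep_eq]] := representatives label A.
exists (rep @: A), lev; split.
- by move=> _ /imsetP[x xA ->]; have [+ _ _] := levP _ (repA x xA).1.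
- move=> x xA; exists (rep x); first exact: imset_f.
  by have [_ [<- ->]] := repA x xA.
have label_eq x x' : x \in A -> x' \in A -> anc (lev x) x' = anc (lev x) x ->
    label x' = label x.
  move=> xA x'A E; have [kx Sx minx] := levP x xA.
  have [kx' Sx' minx'] := levP x' x'A.
  have le1 : (lev x' <= lev x)%N.
    by apply: minx' => //; rewrite /mass E.
  have E' : anc (lev x') x' = anc (lev x') x.
    by apply: (anc_le _ E); rewrite le1; case/andP: kx.
  have le2 : (lev x <= lev x')%N by apply: minx => //; rewrite /mass -E'.
  have El : lev x' = lev x by apply/eqP; rewrite eqn_leq le1.
  by rewrite /label El E.
rewrite [leRHS](bigID (fun x => x \in A))/= ler_wpDr ?sumr_ge0//.
rewrite [leRHS](partition_big rep (fun r => r \in rep @: A))/=; last first.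
  by move=> x; exact: imset_f.
apply: ler_sum => _ /imsetP[x xA ->].
set r := rep x; have [rA rx] := repA x xA.
have [_ <- _] := levP r rA; rewrite /mass big_mkcond [leRHS]big_mkcond.
apply: ler_sum => x' _; case: ifP => [/eqP E|_]; last by case: ifP.
case x'A: (x' \in A) => /=.
  rewrite ifT//; apply/eqP; rewrite /r; apply: rep_eq => //.
  by rewrite -rx; apply: label_eq.
by rewrite leNgt; apply/negP => /wA; rewrite x'A.
Qed.

End saturated_weights.

(** [code] certifies that at most [#|F|] classes of [anc] meet [B]. *)
Lemma sum_le_codes {R : realType} (I F : finType) (T : eqType) (anc : I -> T)
    (code : I -> F) (B : pred I) (w : I -> R) (b : R) :
  0 <= b -> (forall x, 0 <= w x) ->
  (forall x, \sum_(x' | anc x' == anc x) w x' <= b) ->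
  (forall x x', B x -> B x' -> code x = code x' -> anc x = anc x') ->
  \sum_(x | B x) w x <= #|F|%:R * b.
Proof.
move=> b0 w0 wb cB; rewrite (partition_big code xpredT)//= mulr_natl.
rewrite -sumr_const; apply: ler_sum => f _.
have [x /andP[Bx /eqP xf]|noB] := pickP (fun x => B x && (code x == f)); last first.
  by rewrite big_pred0.
apply: le_trans (wb x); rewrite big_mkcond [leRHS]big_mkcond; apply: ler_sum => x' _.
case: ifP => [/andP[Bx' /eqP x'f]|_]; last by case: ifP.
by rewrite (cB x' x)// ?eqxx// xf.
Qed.

Lemma hausdorff_gauge_ge0 {R : realType} d s (U : set 'rV[R]_d) :
  (0 <= hausdorff_gauge s U)%E.
Proof. by rewrite /hausdorff_gauge; case: ifP => // _; exact: poweR_ge0. Qed.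

Lemma hausdorff_content_le_sum {R : realType} d (J : finType) (P : {set J})
    (U : J -> set 'rV[R]_d) (delta s : R) (A : set 'rV[R]_d) (r0 : J) :
  {in P, forall r, (eucl_diam (U r) <= delta%:E)%E} ->
  (forall p, A p -> exists2 r, r \in P & U r p) ->
  (hausdorff_content delta s A <= \sum_(r in P) hausdorff_gauge s (U r))%E.
Proof.
(* The finite cover is continued by empty sets, whose gauge is 0. *)
move=> diamU AU; pose e := enum P.
pose V i := if (i < size e)%N then U (nth r0 e i) else set0.
have -> : (\sum_(r in P) hausdorff_gauge s (U r) =
    \sum_(0 <= i <oo) hausdorff_gauge s (V i))%E.
  rewrite (nneseries_split 0 (size e)); last by move=> *; exact: hausdorff_gauge_ge0.
  rewrite add0n [X in (_ + X)%E]eseries0 ?adde0; last first.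
    by move=> i ei _; rewrite /V ltnNge ei /= /hausdorff_gauge eqxx.
  rewrite -big_enum (big_nth r0) big_nat [RHS]big_nat; apply: eq_bigr => i /andP[_ ie].
  by rewrite /V ie.
apply: ereal_inf_lbound; exists V => //; split=> [i|p /AU[r rP Urp]].
  rewrite /V; case: ifP => ie; first by apply: diamU; rewrite -mem_enum mem_nth.
  by apply: ge_ereal_sup => _ [x []].
exists (index r e) => //; have re : r \in e by rewrite mem_enum.
by rewrite /V index_mem re nth_index.
Qed.

(** * Dyadic cubes and their Frostman weights *)

Section dyadic.
Context {R : realType} {d M : nat}.

Definition dyadic n := {ffun 'I_d -> 'I_(2 * M * 2 ^ n)}.

(* Lower corner of a dyadic cube of side [2 ^ -n] in [[-M, M[ ^ d]. *)
Definition dyadic_pos n (x : dyadic n) : 'rV[R]_d :=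
  \row_l ((x l)%:R / (2 ^ n)%N%:R - M%:R).

Definition dyadic_cell n (x : dyadic n) : set 'rV[R]_d :=
  [set p | forall l, (x l)%:R <= (2 ^ n)%N%:R * (p ord0 l + M%:R) < (x l).+1%:R].

(** Values in [nat] rather than in an ordinal depending on [j]: [frostman_weights] takes one type
    for all levels. *)
Definition dyadic_anc n j (x : dyadic n) : {ffun 'I_d -> nat} :=
  [ffun l => (x l %/ 2 ^ (n - j))%N].

Let pow2_gt0 n : 0 < (2 ^ n)%N%:R :> R. Proof. by rewrite ltr0n expn_gt0. Qed.

Lemma dyadic_cell_exists n (p : 'rV[R]_d) : (forall l, `|p ord0 l| < M%:R) ->
  exists x : dyadic n, dyadic_cell x p.
Proof.
move=> pM; have N0 := pow2_gt0 n.
pose t l := (2 ^ n)%N%:R * (p ord0 l + M%:R).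
have t0 l : 0 <= t l by rewrite mulr_ge0 ?(ltW N0)//; have := pM l; rewrite ltr_norml; lra.
have tM l : (Num.truncn (t l) < 2 * M * 2 ^ n)%N.
  rewrite truncn_lt_nat//  natrM mulrC ltr_pM2l// natrM.
  by have := pM l; rewrite ltr_norml; lra.
exists [ffun l => Ordinal (tM l)] => l; rewrite ffunE /=.
exact: truncn_itv.
Qed.

Lemma dyadic_pos_le n (x : dyadic n) l : `|dyadic_pos x ord0 l| <= M%:R.
Proof.
rewrite mxE ler_norml; have N0 := pow2_gt0 n.
have x0 : 0 <= (x l)%:R / (2 ^ n)%N%:R :> R by rewrite divr_ge0 // ltW.
have : (x l)%:R / (2 ^ n)%N%:R <= 2 * M%:R :> R.
  by rewrite ler_pdivrMr// -!natrM ler_nat ltnW.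
lra.
Qed.

Lemma dyadic_pos_lattice n (x : dyadic n) l : dyadic_pos x ord0 l =
  ((x l)%:Z - (M * 2 ^ n)%N%:Z)%:~R / (2 ^ n)%N%:R.
Proof.
by rewrite mxE rmorphB/= -!pmulrn natrM; field; rewrite gt_eqF.
Qed.

Lemma dyadic_cell_near n (x : dyadic n) p : dyadic_cell x p ->
  near p (dyadic_pos x) (2 ^ n)%N%:R^-1.
Proof.
move=> xp; have N0 := pow2_gt0 n; apply/forallP => l; have := xp l.
rewrite mxE -natr1 => /andP[x1 x2].
rewrite -(ler_pM2l N0) mulfV ?gt_eqF// -[X in X * `|_|](gtr0_norm N0) -normrM.
rewrite mulrBr mulrBr mulrCA mulfV ?gt_eqF// mulr1 mulrDr in x1 x2 *.
by rewrite ler_norml; lra.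
Qed.

Lemma dyadic_anc_inj n : injective (@dyadic_anc n n).
Proof.
move=> x x' /ffunP xx'; apply/ffunP => l; apply: val_inj.
by have := xx' l; rewrite !ffunE subnn expn0 !divn1.
Qed.

Lemma dyadic_anc_refine n j (x x' : dyadic n) : (j < n)%N ->
  dyadic_anc j.+1 x = dyadic_anc j.+1 x' -> dyadic_anc j x = dyadic_anc j x'.
Proof.
move=> jn /ffunP xx'; apply/ffunP => l; have := xx' l; rewrite !ffunE.
have -> : (n - j = (n - j.+1).+1)%N by lia.
by rewrite expnSr !divnMA => ->.
Qed.

Definition dyadic_cube n j (x : dyadic n) : set 'rV[R]_d :=
  [set p | exists2 x' : dyadic n, dyadic_anc j x' = dyadic_anc j x & dyadic_cell x' p].

Lemma dyadic_cube_coord n j (x : dyadic n) p p' l : (j <= n)%N ->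
  dyadic_cube j x p -> dyadic_cube j x p' ->
  `|(p - p') ord0 l| <= (2 ^ j)%N%:R^-1.
Proof.
move=> jn [y yx yp] [z zx zp]; have N0 := pow2_gt0 n; have D0 := pow2_gt0 (n - j).
set a := (x l %/ 2 ^ (n - j))%N.
have bnd (t : dyadic n) q : dyadic_anc j t = dyadic_anc j x -> dyadic_cell t q ->
    a%:R * (2 ^ (n - j))%N%:R <= (2 ^ n)%N%:R * (q ord0 l + M%:R) <=
    (a%:R + 1) * (2 ^ (n - j))%N%:R.
  move=> /ffunP/(_ l); rewrite !ffunE -/a => ta /(_ l) /andP[q1 q2].
  apply/andP; split.
    by apply: le_trans q1; rewrite -natrM ler_nat -ta leq_trunc_div.
  apply: le_trans (ltW q2) _; rewrite natr1 -natrM ler_nat -ta.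
  by apply: ltn_ceil; rewrite expn_gt0.
have /andP[y1 y2] := bnd _ _ yx yp; have /andP[z1 z2] := bnd _ _ zx zp.
have NE : (2 ^ n)%N%:R = (2 ^ j)%N%:R * (2 ^ (n - j))%N%:R :> R.
  by rewrite -natrM -expnD subnKC.
rewrite -(ler_pM2l N0) -[X in X * `|_|](gtr0_norm N0) -normrM {2}NE.
rewrite mulrAC mulfV ?mul1r ?gt_eqF// !mxE ler_norml.
lra.
Qed.

Lemma dyadic_cube_diam n j (x : dyadic n) : (j <= n)%N ->
  (eucl_diam (dyadic_cube j x) <= (d.+1%:R / (2 ^ j)%N%:R)%:E)%E.
Proof.
move=> jn; apply: ge_ereal_sup => _ [p xp [p' xp' <-]]; rewrite lee_fin /eucl_dist.
have r0 : 0 <= d.+1%:R / (2 ^ j)%N%:R :> R by rewrite divr_ge0.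
rewrite -(ger0_norm r0) -sqrtr_sqr; apply: ler_wsqrtr.
apply: (@le_trans _ _ (\sum_(l < d) (2 ^ j)%N%:R^-1 ^+ 2)).
  apply: ler_sum => l _; rewrite -expr2 -real_normK ?num_real//.
  rewrite lerXn2r ?nnegrE ?invr_ge0//.
  exact: dyadic_cube_coord xp xp'.
rewrite sumr_const card_ord -(mulr_natl (_ ^+ 2)) exprMn ler_wpM2r ?exprn_ge0 ?invr_ge0//.
by rewrite -natrX ler_nat expnS expn1; nia.
Qed.

Lemma gauge_dyadic_cube n j (x : dyadic n) s : (j <= n)%N -> 0 <= s ->
  (hausdorff_gauge s (dyadic_cube j x) <= ((d.+1%:R / (2 ^ j)%N%:R) `^ s)%:E)%E.
Proof.
move=> jn s0; rewrite /hausdorff_gauge; case: ifPn => [_|/set0P[p xp]].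
  by rewrite lee_fin powR_ge0.
rewrite -poweR_EFin; apply: gt0_ler_poweR => //.
- rewrite in_itv /= leey andbT; apply: (@le_trans _ _ (eucl_dist p p)%:E).
    by rewrite lee_fin sqrtr_ge0.
  by apply: ereal_sup_ubound; exists p => //; exists p.
- by rewrite in_itv /= leey andbT lee_fin divr_ge0.
- exact: dyadic_cube_diam.
Qed.

(** In units of 2^-j each coordinate of the corner ranges over an interval of length 2, so its
    integer part takes at most three values, from [t l] on. *)
Lemma dyadic_near_code n j (p : 'rV[R]_d) : (j <= n)%N ->
  exists code : dyadic n -> {ffun 'I_d -> 'I_3}, forall x x',
    near (dyadic_pos x) p (2 ^ j)%N%:R^-1 -> near (dyadic_pos x') p (2 ^ j)%N%:R^-1 ->
    code x = code x' -> dyadic_anc j x = dyadic_anc j x'.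
Proof.
move=> jn; pose t l : int := Num.floor ((2 ^ j)%N%:R * (p ord0 l + M%:R) - 1).
exists (fun x => [ffun l => inord `|((dyadic_anc j x l)%:Z - t l)%R|%N]).
have N0 := pow2_gt0 n; have J0 := pow2_gt0 j; have D0 := pow2_gt0 (n - j).
have bnd (x : dyadic n) l : near (dyadic_pos x) p (2 ^ j)%N%:R^-1 ->
    (t l <= (dyadic_anc j x l)%:Z <= t l + 2)%R.
  move=> /forallP/(_ l); rewrite mxE ler_norml => /andP[x1 x2].
  have E : (2 ^ j)%N%:R * ((x l)%:R / (2 ^ n)%N%:R) = (x l)%:R / (2 ^ (n - j))%N%:R :> R.
    have -> : (2 ^ n)%N%:R = (2 ^ j)%N%:R * (2 ^ (n - j))%N%:R :> R.
      by rewrite -natrM -expnD subnKC.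
    by field; rewrite !gt_eqF.
  have {}x1 := ler_wpM2l (ltW J0) x1; have {}x2 := ler_wpM2l (ltW J0) x2.
  move: x1 x2; rewrite mulrN mulfV ?gt_eqF// mulrBr mulrBr E => x1 x2.
  have /andP[t1 t2] := floor_itv ((2 ^ j)%N%:R * (p ord0 l + M%:R) - 1).
  rewrite -/(t l) intrD in t1 t2.
  have a1 : (dyadic_anc j x l)%:R <= (x l)%:R / (2 ^ (n - j))%N%:R :> R.
    by rewrite ler_pdivlMr// -natrM ler_nat ffunE leq_trunc_div.
  have a2 : (x l)%:R / (2 ^ (n - j))%N%:R < (dyadic_anc j x l)%:R + 1 :> R.
    by rewrite ltr_pdivrMr// natr1 -natrM ltr_nat ffunE ltn_ceil ?expn_gt0.
  rewrite mulrDr in t1 t2.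
  apply/andP; split; rewrite -ltzD1 -(ltr_int R) !intrD -!pmulrn; lra.
move=> x x' xp x'p /ffunP cx; apply/ffunP => l.
have := bnd x l xp; have := bnd x' l x'p; have := cx l.
rewrite !(@ffunE _ (fun=> 'I_3)) => /inord_inj.
move: (t l) (dyadic_anc j x l) (dyadic_anc j x' l) => z a a' h b' b.
by have := h ltac:(lia) ltac:(lia); lia.
Qed.

Lemma discrete_frostman (E : set 'rV[R]_d) (s delta c : R) : (0 < M)%N ->
  0 <= s -> 0 < delta -> 0 < c -> (forall p, E p -> forall l, `|p ord0 l| < M%:R) ->
  (c%:E <= hausdorff_content delta s E)%E ->
  exists C c0 n0, [/\ 0 <= C, 0 < c0 & forall n, (n0 <= n)%N ->
    exists w : dyadic n -> R,
      [/\ forall x, 0 <= w x, frostman (@dyadic_pos n) w s C (2 ^ n)%N%:R^-1,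
          c0 <= \sum_x w x &
          forall x, 0 < w x -> exists2 p, E p & near p (dyadic_pos x) (2 ^ n)%N%:R^-1]].
Proof.
move=> M0 s0 delta0 c0 EM cE.
(* Cubes of level at least [k] have diameter at most [delta], so they are admissible in the
   content. *)
pose k := Num.bound (d.+1%:R / delta).
pose b (j : nat) : R := (2 ^ j)%N%:R^-1 `^ s.
have b0 j : 0 < b j by rewrite powR_gt0// invr_gt0.
pose C1 : R := #|{ffun 'I_d -> 'I_3}|%:R * 2 `^ s.
pose C2 : R := #|{ffun 'I_d -> 'I_(2 * M * 2 ^ k).+1}|%:R.
have C10 : 0 <= C1 by rewrite mulr_ge0 ?powR_ge0.
(* [C1] serves radii up to 2^-k, for which some level has r <= 2^-j <= 2r and 3^d cells suffice;
   [C2] serves larger radii by counting all cells of level [k]. The divisor of [c] comes from the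
   diameter bound (d+1) 2^-j. *)
exists (C1 + C2), (c / d.+1%:R `^ s), k; split.
- by rewrite addr_ge0.
- by rewrite divr_gt0// powR_gt0.
move=> n kn.
pose A := [set x : dyadic n | `[< exists2 p, E p & dyadic_cell x p >]]%SET.
have [w [w0 wA wb [P [lev [Pk PA Pw]]]]] :=
  frostman_weights A b0 (@dyadic_anc_inj n)
    (fun j x x' jn => @dyadic_anc_refine n j x x' jn) kn.
exists w; split=> //.
- move=> p r nr; have r0 : 0 < r by apply: lt_le_trans nr; rewrite invr_gt0.
  have [rk|kr] := leP r (2 ^ k)%N%:R^-1.
    have [j /andP[kj jn] /andP[rj jr]] : exists2 j, (k <= j <= n)%N &
        r <= (2 ^ j)%N%:R^-1 <= 2 * r.
      have ex : exists j, (k <= j <= n)%N && (r <= (2 ^ j)%N%:R^-1).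
        by exists k; rewrite leqnn kn.
      have bd j : (k <= j <= n)%N && (r <= (2 ^ j)%N%:R^-1) -> (j <= n)%N.
        by case/andP => /andP[].
      case: (ex_maxnP ex bd) => j /andP[/andP[kj jn] rj] maxj.
      exists j; rewrite ?kj ?rj//=.
      have [->|jNn] := eqVneq j n; first by move: nr; lra.
      have jn' : (j < n)%N by rewrite ltn_neqAle jNn.
      have := contraNN (maxj j.+1); rewrite ltnn jn' (leq_trans kj)//= => /(_ isT).
      rewrite -ltNge expnS natrM invfM => /ltW.
      by rewrite mulrC ler_pdivrMr// mulrC.
    have [code codeP] := dyadic_near_code p jn.
    apply: (@le_trans _ _ (#|{ffun 'I_d -> 'I_3}|%:R * b j)).
      apply: sum_le_codes (ltW (b0 j)) w0 (fun x => wb j x _) _; first by rewrite kj.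
      move=> x x' /forallP xr /forallP x'r; apply: codeP; apply/forallP => l.
        exact: le_trans (xr l) rj.
      exact: le_trans (x'r l) rj.
    apply: (@le_trans _ _ (C1 * r `^ s)); last first.
      by rewrite ler_wpM2r ?powR_ge0// lerDl.
    rewrite /C1 -mulrA ler_wpM2l// -powRM ?(ltW r0)//.
    by rewrite ge0_ler_powR ?nnegrE ?invr_ge0 ?mulr_ge0 ?(ltW r0).
  apply: (@le_trans _ _ (\sum_x w x)).
    by rewrite big_mkcond; apply: ler_sum => x _; case: ifP.
  apply: (@le_trans _ _ (C2 * b k)).
    pose code (x : dyadic n) : {ffun 'I_d -> 'I_(2 * M * 2 ^ k).+1} :=
      [ffun l => inord (dyadic_anc k x l)].
    apply: (sum_le_codes (code := code)) (ltW (b0 k)) w0 (fun x => wb k x _) _.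
      by rewrite leqnn.
    move=> x x' _ _ /ffunP cx; apply/ffunP => l; have := cx l.
    have bnd (y : dyadic n) : (dyadic_anc k y l < (2 * M * 2 ^ k).+1)%N.
      have NE : (2 * M * 2 ^ k * 2 ^ (n - k) = 2 * M * 2 ^ n)%N.
        by rewrite -mulnA -expnD subnKC.
      by rewrite ffunE ltnS ltnW// ltn_divLR ?expn_gt0// NE.
    by rewrite !(@ffunE _ (fun=> 'I_(2 * M * 2 ^ k).+1)) => /inord_inj; apply.
  apply: (@le_trans _ _ (C2 * r `^ s)); last first.
    by rewrite ler_wpM2r ?powR_ge0// lerDr.
  rewrite ler_wpM2l// ge0_ler_powR ?nnegrE ?invr_ge0 ?(ltW r0)//; exact: ltW.
- rewrite ler_pdivrMr ?powR_gt0//.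
  have N2 : (0 < 2 * M * 2 ^ n)%N by rewrite !muln_gt0 M0 expn_gt0.
  have diamP : {in P, forall r, (eucl_diam (dyadic_cube (lev r) r) <= delta%:E)%E}.
    move=> r rP; have /andP[kr rn] := Pk r rP.
    apply: (le_trans (dyadic_cube_diam _ rn)).
    rewrite lee_fin ler_pdivrMr// mulrC -ler_pdivrMr//.
    apply: le_trans (ltW (archi_boundP _)) _; first by rewrite divr_ge0// ltW.
    rewrite ler_nat; apply: (leq_trans _ (leq_pexp2l _ kr)) => //.
    by rewrite ltnW// ltn_expl.
  have cov p : E p -> exists2 r, r \in P & dyadic_cube (lev r) r p.
    move=> Ep; have [x xp] := dyadic_cell_exists n (EM p Ep).
    have xA : x \in A by rewrite inE; apply/asboolP; exists p.
    by have [r rP E'] := PA x xA; exists r => //; exists x.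
  have := le_trans cE (hausdorff_content_le_sum s [ffun=> Ordinal N2] diamP cov).
  move=> h; rewrite -lee_fin; apply: (le_trans h).
  apply: (@le_trans _ _ (\sum_(r in P) (d.+1%:R `^ s * b (lev r))%:E)%E).
    apply: lee_sum => r rP; have /andP[_ rn] := Pk r rP.
    apply: (le_trans (gauge_dyadic_cube _ rn s0)).
    by rewrite lee_fin powRM ?invr_ge0.
  rewrite sumEFin lee_fin -mulr_sumr mulrC.
  by rewrite ler_wpM2r ?powR_ge0.
move=> x /wA; rewrite inE => /asboolP[p Ep xp]; exists p => //.
exact: dyadic_cell_near.
Qed.

End dyadic.

(** * Measures of grid neighbourhoods *)

Section grid.
Context {R : realType}.
Variable k : nat.
Local Notation RR := (measurableTypeR R).

Let pow2_gt0 n : 0 < (2 ^ n)%N%:R :> R. Proof. by rewrite ltr0n expn_gt0. Qed.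

Definition grid_index n (v : k.-tuple RR) (i : 'I_k) : int :=
  Num.floor ((2 ^ n)%N%:R * (tnth v i : R)).

Definition grid_box n (z : {ffun 'I_k -> int}) : set (k.-tuple RR) :=
  [set v | forall i, grid_index n v i = z i].

Lemma measurable_tuple_box (A : 'I_k -> set RR) : (forall i, measurable (A i)) ->
  measurable [set t : k.-tuple RR | forall i, A i (tnth t i)].
Proof.
move=> mA; rewrite (_ : [set t | _] =
    \bigcap_(i in [set: 'I_k]) ((fun t : k.-tuple RR => tnth t i) @^-1` A i)).
  apply: fin_bigcap_measurable => // i _; rewrite -[X in measurable X]setTI.
  exact: measurable_tnth.
by apply/seteqP; split=> [t At i _|t At i]; exact: At.
Qed.

Definition grid_itv n (z : int) : set RR :=
  `[z%:~R / (2 ^ n)%N%:R, (z%:~R + 1) / (2 ^ n)%N%:R[%classic.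

Let grid_boxE n z : grid_box n z = [set t | forall i, grid_itv n (z i) (tnth t i)].
Proof.
have N0 := pow2_gt0 n.
apply/seteqP; split=> v /= vz i.
  rewrite /grid_itv /= in_itv /= ler_pdivrMr// ltr_pdivlMr// mulrC.
  by have := floor_itv ((2 ^ n)%N%:R * (tnth v i : R)); rewrite -(vz i) intrD.
have := vz i; rewrite /grid_itv /= in_itv /= ler_pdivrMr// ltr_pdivlMr// mulrC => vi.
by apply: floor_def; rewrite intrD.
Qed.

Lemma measurable_grid_box n z : measurable (grid_box n z).
Proof.
rewrite grid_boxE; apply: (measurable_tuple_box (A := fun i => grid_itv n (z i))).
by move=> i; exact: measurable_itv.
Qed.

Lemma lebesgue_grid_box n z :
  lebesgue_tuple k (grid_box n z) = ((2 ^ n)%N%:R ^- k)%:E.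
Proof.
have N0 := pow2_gt0 n.
rewrite grid_boxE (lebesgue_tuple_box (A := fun i => grid_itv n (z i))); last first.
  by move=> i; exact: measurable_itv.
under eq_bigr => i _.
  rewrite (_ : lebesgue_measure _ = ((2 ^ n)%N%:R^-1)%:E); first over.
  rewrite lebesgue_measure_itv /= lte_fin ltr_pM2r ?invr_gt0// ltrDl ltr01.
  by rewrite -EFinB -mulrBl addrC addKr mul1r.
by rewrite -(big_morph _ (@EFinM R) (erefl 1%:E)) prodr_const card_ord exprVn.
Qed.

(** There are countably many grid boxes, so the set is a countable union of them whatever [B] is; in
    [measurable_nbd], [B] is an existential over a compact set. *)
Lemma measurable_grid_invariant n (B : ('I_k -> int) -> Prop) :
  measurable [set v : k.-tuple RR | B (grid_index n v)].
Proof.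
rewrite (_ : [set v | _] = \bigcup_(z : {ffun 'I_k -> int}) (if `[< B z >] then grid_box n z else set0)).
  apply: countable_bigcupT_measurable; first exact: countableP.
  by move=> z; case: ifP => // _; exact: measurable_grid_box.
apply/seteqP; split=> [v Bv|v [z _]].
  exists [ffun i => grid_index n v i] => //.
  have E : [ffun i => grid_index n v i] = grid_index n v :> ('I_k -> int).
    by apply/funext => i; rewrite ffunE.
  by rewrite E ifT; [move=> i; rewrite ffunE|apply/asboolP].
case: ifP => // /asboolP Bz vz /=.
by rewrite (_ : grid_index n v = z)//; apply/funext.
Qed.

Lemma lebesgue_grid_boxes (J : finType) (P : {set J}) n (z : J -> 'I_k -> int)
    (V : set (k.-tuple RR)) : measurable V ->
  {in P &, forall a b, z a =1 z b -> a = b} ->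
  {in P, forall a v, grid_index n v =1 z a -> V v} ->
  ((#|P|%:R * (2 ^ n)%N%:R ^- k)%:E <= lebesgue_tuple k V)%E.
Proof.
move=> mV z_inj PV; pose F a := grid_box n [ffun i => z a i].
have FE a v : F a v -> grid_index n v =1 z a by move=> h i; rewrite h ffunE.
have mF a : measurable (F a) by exact: measurable_grid_box.
have -> : (#|P|%:R * (2 ^ n)%N%:R ^- k)%:E = (\sum_(a \in [set` P]) lebesgue_tuple k (F a))%E.
  rewrite (eq_fsbigr (fun=> ((2 ^ n)%N%:R ^- k)%:E)); last first.
    by move=> a _; rewrite lebesgue_grid_box.
  rewrite -(@bigfs _ _ _ _ (index_enum J)) ?index_enum_uniq//; last first.
    by move=> a _; rewrite mem_index_enum.
  by rewrite sumEFin sumr_const mulr_natl.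
rewrite -measure_fin_bigcup//; last 1 first.
- move=> a b /= aP bP [v [Fa Fb]]; apply: z_inj => // i.
  by rewrite -(FE _ _ Fa) (FE _ _ Fb).
apply: le_measure; rewrite ?inE//.
  by apply: fin_bigcup_measurable.
by move=> v [a /= aP Fav]; apply: (PV a aP); exact: FE.
Qed.

End grid.

Lemma continuous_sum {R : realType} {X : topologicalType} (J : Type) (r : seq J)
    (F : J -> X -> R) :
  (forall j, continuous (F j)) -> continuous (fun x => \sum_(j <- r) F j x).
Proof.
move=> cF; elim: r => [|j r IH] x.
  by under eq_fun do rewrite big_nil; exact: cvg_cst.
under eq_fun do rewrite big_cons.
by apply: cvgD; [exact: cF|exact: IH].
Qed.

Section grid_limit.
Context {R : realType} {X : topologicalType} {k : nat}.
Local Notation RR := (measurableTypeR R).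
Variables (K : set X) (lam : X -> 'I_k -> R) (C : R).
Hypotheses (cK : compact K) (lam_cont : forall i, continuous (lam^~ i)) (C1 : 1 <= C).

Let pow2_gt0 n : 0 < (2 ^ n)%N%:R :> R. Proof. by rewrite ltr0n expn_gt0. Qed.

(* Neighbourhoods of the image of [K], made of cells of side [2 ^ -n]. *)
Let nbd n : set (k.-tuple RR) := [set v | exists x, K x /\
  forall i, `|(grid_index n v i)%:~R - (2 ^ n)%N%:R * lam x i| <= C].

(** The floor of 2t is twice the floor of t, plus 0 or 1, so an error [C] becomes at most (C + 1) /
    2 at the coarser scale; this is at most [C] because [C >= 1]. *)
Let nbdS n : nbd n.+1 `<=` nbd n.
Proof.
move=> v [x [Kx vx]]; exists x; split=> // i; move: (vx i); rewrite /grid_index.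
have -> : (2 ^ n.+1)%N%:R = 2 * (2 ^ n)%N%:R :> R by rewrite expnS natrM.
rewrite -!mulrA; set t := (2 ^ n)%N%:R * (tnth v i : R); set l := _ * lam x i.
have /andP[a1 a2] := floor_itv t; have /andP[b1 b2] := floor_itv (2 * t).
have ab1 : 2 * Num.floor t <= Num.floor (2 * t).
  by rewrite floor_ge_int intrM ler_pM2l.
have ab2 : Num.floor (2 * t) <= 2 * Num.floor t + 1.
  by rewrite -ltzD1 -(ltr_int R) !intrD !intrM; move: a2; rewrite intrD; lra.
move: ab1 ab2; rewrite -!(ler_int R) intrD intrM => ab1 ab2.
by have := C1; rewrite !ler_norml => ? /andP[? ?]; apply/andP; split; lra.
Qed.

Let nbd_le m n : (m <= n)%N -> nbd n `<=` nbd m.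
Proof.
elim: n => [|n IH]; first by rewrite leqn0 => /eqP ->.
rewrite leq_eqVlt ltnS => /orP[/eqP -> //|/IH mn].
exact: subset_trans (@nbdS n) mn.
Qed.

Let nbd_near n v : nbd n v -> exists2 x, K x &
  forall i, `|(tnth v i : R) - lam x i| <= (C + 1) / (2 ^ n)%N%:R.
Proof.
move=> [x [Kx vx]]; exists x => // i; have N0 := pow2_gt0 n.
rewrite ler_pdivlMr// mulrC -[X in X * `|_|](gtr0_norm N0) -normrM mulrBr.
have := vx i; rewrite /grid_index.
have /andP[] := floor_itv ((2 ^ n)%N%:R * (tnth v i : R)).
by rewrite intrD !ler_norml => ? ? /andP[? ?]; apply/andP; split; lra.
Qed.

Let image : set (k.-tuple RR) := [set v | exists x, K x /\ forall i, tnth v i = lam x i].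

Let bigcap_nbd m : \bigcap_n nbd (m + n) = image.
Proof.
apply/seteqP; split=> [v vn|v [x [Kx vx]] n _]; last first.
  exists x; split=> // i; rewrite /grid_index vx.
  have /andP[] := floor_itv ((2 ^ (m + n))%N%:R * lam x i).
  by rewrite intrD ler_norml => ? ?; have := C1 => ?; apply/andP; split; lra.
(* The l1 distance from [v] to [lam x] comes arbitrarily close to 0 on [K]; its set of values is
   compact, hence closed, so 0 is attained. *)
pose f x := \sum_i `|(tnth v i : R) - lam x i|.
have f_cont : continuous f.
  apply: continuous_sum => i x.
  by apply: cvg_norm; apply: cvgB; [exact: cvg_cst|exact: lam_cont].
have f_closed : closed (f @` K).
  apply: compact_closed; first exact: Rhausdorff.
  by apply: continuous_compact => //; exact: continuous_subspaceT.
have f0 : (f @` K) 0.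
  apply: f_closed => B /nbhs_ballP[e /= e0 eB].
  pose n := Num.bound (k%:R * (C + 1) / e).
  have [x Kx xv] := nbd_near (vn n I).
  exists (f x); split; first by exists x.
  apply: eB; rewrite /ball/= sub0r normrN ger0_norm ?sumr_ge0//.
  apply: (@le_lt_trans _ _ (\sum_(i < k) (C + 1) / (2 ^ (m + n))%N%:R)).
    by apply: ler_sum => i _; exact: xv.
  have Ck : 0 <= k%:R * (C + 1) / e.
    by rewrite divr_ge0 ?(ltW e0)// mulr_ge0//; have := C1; lra.
  have key : k%:R * (C + 1) / e < (2 ^ (m + n))%N%:R.
    apply: lt_le_trans (archi_boundP Ck) _; rewrite ler_nat.
    apply: leq_trans (ltnW (ltn_expl _ (isT : 1 < 2)%N)) _.
    by rewrite leq_exp2l// leq_addl.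
  rewrite sumr_const card_ord -(mulr_natl (_ / _)) mulrA ltr_pdivrMr ?pow2_gt0//.
  by rewrite (mulrC e) -ltr_pdivrMr.
have [x Kx fx0] := f0; exists x; split=> // i.
apply/eqP; rewrite -subr_eq0 -normr_eq0.
have h := psumr_eq0P (fun j _ => normr_ge0 ((tnth v j : R) - lam x j)) fx0.
by apply/eqP; exact: h.
Qed.

Lemma measurable_nbd n : measurable (nbd n).
Proof.
exact: (@measurable_grid_invariant R k n (fun z => exists x, K x /\
  forall i, `|(z i)%:~R - (2 ^ n)%N%:R * lam x i| <= C)).
Qed.

(** Continuity from above requires finite measure; [lam] is bounded on the compact [K]. *)
Let nbd0_finite n : (lebesgue_tuple k (nbd n) < +oo)%E.
Proof.
have /choice[B BK] i : exists B, forall x, K x -> `|lam x i| <= B.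
  have : bounded_set ((lam^~ i) @` K).
    apply: compact_bounded; apply: continuous_compact => //.
    exact: continuous_subspaceT.
  case=> B [_ hB]; exists (B + 1) => x Kx.
  by apply: (hB (B + 1)); [rewrite ltrDl|exists x].
pose itv i : set RR := `[- (B i + (C + 1)), B i + (C + 1)]%classic.
have mitv i : measurable (itv i) by exact: measurable_itv.
have mbox := measurable_tuple_box mitv.
apply: (@le_lt_trans _ _ (lebesgue_tuple k [set v | forall i, itv i (tnth v i)])).
  apply: le_measure; rewrite ?inE//; first exact: measurable_nbd.
  move=> v /nbd_near[x Kx vx] i; rewrite /itv /= in_itv /=.
  have := vx i; have := BK i x Kx.
  have : (C + 1) / (2 ^ n)%N%:R <= C + 1.
    rewrite ler_pdivrMr ?pow2_gt0// ler_peMr//; first by have := C1; lra.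
    by rewrite ler1n expn_gt0.
  rewrite !ler_norml; lra.
rewrite (lebesgue_tuple_box mitv) ltey_eq prode_fin_num// => i _.
rewrite lebesgue_measure_itv /=; case: ifP => // _.
Qed.

Lemma lebesgue_image_gt0 (kappa : R) (n0 : nat) : 0 < kappa ->
  (forall n, (n0 <= n)%N -> exists (J : finType) (P : {set J}) (z : J -> 'I_k -> int),
    [/\ {in P &, forall a b, z a =1 z b -> a = b},
        {in P, forall a, exists2 x, K x &
          forall i, `|(z a i)%:~R - (2 ^ n)%N%:R * lam x i| <= C} &
        kappa * (2 ^ n)%N%:R ^+ k <= #|P|%:R]) ->
  (0 < lebesgue_tuple k [set v | exists x, K x /\ forall i, tnth v i = lam x i])%E.
Proof.
move=> k0 many.
apply: (@lt_le_trans _ _ kappa%:E); first by rewrite lte_fin.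
rewrite -/image -(bigcap_nbd n0).
have cvg : (lebesgue_tuple k \o (fun n => nbd (n0 + n))) x @[x --> \oo] -->
    lebesgue_tuple k (\bigcap_n nbd (n0 + n)).
  apply: nonincreasing_cvg_mu => [|n||m n mn].
  - exact: nbd0_finite.
  - exact: measurable_nbd.
  - by apply: bigcap_measurable => // n _; exact: measurable_nbd.
  - by apply/subsetPset; apply: nbd_le; rewrite leq_add2l.
apply: cvge_ge cvg; apply: nearW => n /=.
have [J [P [z [zinj zK zP]]]] := many (n0 + n)%N (leq_addr _ _).
apply: le_trans (lebesgue_grid_boxes (n := (n0 + n)%N) (measurable_nbd _) zinj _).
  by rewrite lee_fin ler_pdivlMr// exprn_gt0.
move=> a aP v va; have [x Kx xz] := zK a aP; exists x; split=> // i.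
by rewrite va.
Qed.

End grid_limit.

(** * From the dimension hypothesis to the count of cells *)

Lemma hausdorff_dim_content {R : realType} d (E : set 'rV[R]_d) (a : R) : 0 <= a ->
  (a%:E < hausdorff_dim E)%E -> exists s delta c : R,
  [/\ a < s, 0 < delta, 0 < c & (c%:E <= hausdorff_content delta s E)%E].
Proof.
move=> a0 aE.
have [s as_ sE] : exists2 s, a < s & (s%:E < hausdorff_dim E)%E.
  move: aE; case: (hausdorff_dim E) => [r| |//].
    by rewrite lte_fin => ar; exists ((a + r) / 2); rewrite ?lte_fin; lra.
  by exists (a + 1); rewrite ?ltry// ltrDl.
have content_ge0 delta : (0 <= hausdorff_content delta s E)%E.
  apply: le_ereal_inf_tmp => _ [U _ <-]; apply: nneseries_ge0 => n _ _.
  exact: hausdorff_gauge_ge0.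
have [delta delta0 cont0] : exists2 delta : R, 0 < delta &
    (0 < hausdorff_content delta s E)%E.
  (* If every content at exponent [s] vanished, so would the measure, and [s] would be an upper
     bound for the dimension. *)
  apply: contrapT => noc; move: sE; apply/negP; rewrite -leNgt.
  apply: ereal_inf_lbound; exists s => //; split; first exact: le_trans (ltW as_).
  apply/eqP; rewrite eq_le; apply/andP; split.
    apply: ge_ereal_sup => _ [delta /= delta0 <-]; rewrite leNgt; apply/negP => c0.
    by apply: noc; exists delta.
  apply: le_trans (content_ge0 1) _; apply: ereal_sup_ubound.
  by exists 1 => //=; exact: ltr01.
exists s, delta; move: cont0; case: (hausdorff_content delta s E) => [r| |//].
  by rewrite lte_fin => r0; exists r; split.
by exists 1; split; rewrite ?ltr01 ?leey.
Qed.

Lemma dotp_near {R : realType} d (M e : R) (x y x' y' : 'rV[R]_d) :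
  (forall l, `|y ord0 l| <= M) -> (forall l, `|x' ord0 l| <= M) ->
  near x' x e -> near y' y e ->
  `|dotp x y - dotp x' y'| <= d%:R * (2 * M * e).
Proof.
move=> yM xM /forallP xe /forallP ye; rewrite /dotp -sumrB.
apply: (le_trans (ler_norm_sum _ _ _)).
apply: (@le_trans _ _ (\sum_(l < d) 2 * M * e)); last first.
  by rewrite sumr_const card_ord -(mulr_natl (_ * e)).
apply: ler_sum => l _.
rewrite (_ : _ - _ = (x ord0 l - x' ord0 l) * y ord0 l
                     + x' ord0 l * (y ord0 l - y' ord0 l)); last by ring.
apply: (le_trans (ler_normD _ _)); rewrite !normrM.
rewrite (_ : 2 * M * e = e * M + M * e); last by ring.
apply: lerD; apply: ler_pM => //; rewrite distrC; [exact: xe|exact: ye].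
Qed.

Lemma compact_coord_bounded {R : realType} d (E : set 'rV[R]_d) : compact E ->
  exists2 M : nat, (0 < M)%N & forall p, E p -> forall l, `|p ord0 l| < M%:R.
Proof.
move=> cE; have /choice[B BE] l : exists B : nat, forall p, E p -> `|p ord0 l| < B%:R.
  have : bounded_set ((fun p : 'rV[R]_d => p ord0 l) @` E).
    apply: compact_bounded; apply: continuous_compact => //.
    by apply: continuous_subspaceT => p; exact: coord_continuous.
  case=> B [_ hB]; exists (Num.bound (B + 1)) => p Ep.
  have pB : `|p ord0 l| <= B + 1 by apply: (hB (B + 1)); [rewrite ltrDl|exists p].
  apply: (le_lt_trans pB (archi_boundP _)).
  exact: le_trans (normr_ge0 _) pB.
exists (\sum_l B l).+1 => // p Ep l; apply: lt_le_trans (BE l p Ep) _.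
by rewrite ler_nat (bigD1 l)//= leqW// leq_addr.
Qed.

Theorem corollary1 (R : realType) (d k : nat) (T : rel 'I_k.+1)
    (E : set 'rV[R]_d) :
  (1 <= k)%N ->
  is_tree T ->
  #|edges T| = k ->
  compact E ->
  ((d.+1%:R / 2 : R)%:E < hausdorff_dim E)%E ->
  (0 < lebesgue_tuple k (tree_dot_set T E))%E.
Proof.
move=> _ [[Tsym _] Tconn _] Tk cE dimE.
have [|s [delta [c [ds delta0 c0 cE']]]] := hausdorff_dim_content _ dimE.
  by rewrite divr_ge0.
have s0 : 0 <= s by apply: le_trans (ltW ds); rewrite divr_ge0.
have [M M0 EM] := compact_coord_bounded cE.
have [C [w0 [n0 [C0 w00 weights]]]] := discrete_frostman M0 s0 delta0 c0 EM cE'.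
have [kappa kappa0 cells] := pinned_cells M0 C0 ds w00.
pose ep (i : 'I_k) := nth (ord0, ord0) (enum (edges T)) i.
have size_edges : size (enum (edges T)) = k by rewrite -cardE.
(* In the product topology [K] is compact by Tychonoff's theorem and the dot products are continuous
   through the projections. *)
pose Y := prod_topology (fun _ : 'I_k.+1 => 'rV[R]_d).
pose K : set Y := [set x | forall v, E (x v)].
pose lam (x : Y) (i : 'I_k) : R := dotp (x (ep i).1) (x (ep i).2).
have -> : tree_dot_set T E = [set v | exists x, K x /\ forall i, tnth v i = lam x i].
  apply/seteqP; split=> v [x [Ex vx]]; exists x; split=> //.
    move=> i; rewrite (tnth_nth 0) vx (nth_map (ord0, ord0))//.
    by rewrite size_edges.
  apply: (@eq_from_nth _ 0); rewrite ?size_map size_tuple ?size_edges// => i ik.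
  rewrite (nth_map (ord0, ord0)) ?size_edges//.
  by have := vx (Ordinal ik); rewrite (tnth_nth 0).
have cK : compact K.
  exact: (@tychonoff 'I_k.+1 (fun=> 'rV[R]_d) (fun=> E) (fun=> cE)).
have lam_cont i : continuous (lam^~ i).
  apply: continuous_sum => l x.
  have coord v : (fun x : Y => x v ord0 l) x @[x --> x] --> x v ord0 l.
    apply: (@continuous_comp Y 'rV[R]_d R (fun x => x v) (fun p => p ord0 l)).
      exact: proj_continuous.
    exact: coord_continuous.
  exact: (cvgM (coord (ep i).1) (coord (ep i).2)).
(* Replacing two points by corners within 2^-n moves their dot product by at most d (2M) 2^-n; the 1
   pays for the floor in [dot_cell]. *)
pose C3 : R := 1 + d%:R * (2 * M%:R).
have C31 : 1 <= C3 by rewrite lerDl !mulr_ge0.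
(* [n >= M] ensures [M <= 2 ^ n], the range in which [cells] applies. *)
apply: (lebesgue_image_gt0 cK lam_cont C31 (kappa := kappa ^+ k) (n0 := maxn n0 M)).
  by rewrite exprn_gt0.
move=> n; rewrite geq_max => /andP[n0n Mn].
have [w [wge0 fr wsum wE]] := weights n n0n.
have N0 : 0 < (2 ^ n)%N%:R :> R by rewrite ltr0n expn_gt0.
have MN : (M <= 2 ^ n)%N by apply: leq_trans Mn (ltnW (ltn_expl _ _)).
have lattice : exists c : @dyadic d M n -> 'I_d -> int,
    forall x l, dyadic_pos x ord0 l = (c x l)%:~R / (2 ^ n)%N%:R :> R.
  by eexists => x l; exact: dyadic_pos_lattice.
have [G [G0 Gw Gpin]] := cells _ _ _ _ wge0 MN (@dyadic_pos_le R d M n) lattice fr wsum.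
pose q := dot_cell (@dyadic_pos R d M n) (2 ^ n).
have q_sym a b : q a b = q b a by rewrite /q /dot_cell dotpC.
have kN0 : 0 <= kappa * (2 ^ n)%N%:R by rewrite mulr_ge0 ?ltW.
have [X [XG Xsep Xcard]] := tree_growth Tconn Tsym q_sym G0 kN0 Gpin Tk.
exists {ffun 'I_k.+1 -> @dyadic d M n}, X,
  (fun (x : {ffun 'I_k.+1 -> @dyadic d M n}) i => q (x (ep i).1) (x (ep i).2)); split; last by rewrite -exprMn.
  move=> x x' xX x'X qq; apply: Xsep => // p; rewrite -mem_enum => pT.
  have pk : (index p (enum (edges T)) < k)%N.
    by move: pT; rewrite -index_mem size_edges.
  by have := qq (Ordinal pk); rewrite /ep /= nth_index.
move=> x xX.
(* Cubes in [G] have positive weight, so each has a point of [E] near its corner; these points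
   realise the configuration in [E]. *)
have /choice[p pE] v : exists p, E p /\ near p (dyadic_pos (x v)) (2 ^ n)%N%:R^-1.
  by have [p] := wE _ (Gw _ (XG x xX v)); exists p.
exists p; first by move=> v; have [] := pE v.
move=> i; rewrite /q /dot_cell /lam; set u := (ep i).1; set v := (ep i).2.
have [Eu pu] := pE u; have [Ev pv] := pE v.
have := dotp_near (dyadic_pos_le (x v)) (fun l => ltW (EM _ Eu l)) pu pv.
set a := dotp (dyadic_pos _) _; set b := dotp (p u) _ => ab.
have {}ab : `|(2 ^ n)%N%:R * a - (2 ^ n)%N%:R * b| <= d%:R * (2 * M%:R).
  rewrite -mulrBr normrM (gtr0_norm N0) mulrC -ler_pdivlMr//.
  by apply: (le_trans ab); rewrite mulrA.
have /andP[f1 f2] := floor_itv ((2 ^ n)%N%:R * a).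
move: ab f1 f2; rewrite /C3 intrD !ler_norml => /andP[? ?] ? ?.
by apply/andP; split; lra.
Qed.
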